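(* Let $\rho_u>0$, let $X_K$ be a finite-dimensional subspace of $H^1_0(\Omega)$ with $L_2(\Omega)$-orthonormal basis $\{\phi_1,\dots,\phi_{n_K}\}$, and let $\mathcal{T}_\theta^K:L_2(0,t_F)^m\to X_K\subset L_2(\Omega)$, $\mathbf{F}_K(\tau)\in\mathbb{R}^{m\times n_K}$ and $\theta_{ro}\in L_2(\Omega)$ be as defined in the context. Then the equation $$\rho_u\, u+(\mathcal{T}_\theta^K)^*\big[\mathcal{T}_\theta^K[u]-\theta_{ro}\big]=0,\qquad u\in L_2(0,t_F)^m,$$ has a unique solution $u_K$, and it is given by $$u_K(\tau)=\mathbf{F}_K(\tau)\,(\rho_u\mathbf{I}+\mathbf{G}_K)^{-1}\,\bar{\theta}_{ro}^K,\qquad \tau\in[0,t_F],$$ where $\mathbf{G}_K=\int_0^{t_F}\mathbf{F}_K(\tau)^{\mathrm T}\mathbf{F}_K(\tau)\,d\tau$ and $\bar{\theta}_{ro}^K=[\langle\phi_1,\theta_{ro}\rangle\ \cdots\ \langle\phi_{n_K},\theta_{ro}\rangle]^{\mathrm T}$.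
   Context: $\Omega\subset\mathbb{R}^d$ is a bounded, open, connected set, $t_F>0$, $m$ is a positive integer, $\langle\cdot,\cdot\rangle$ is the inner product of $L_2(\Omega)$. Coefficients $a^{ij}=a^{ji},b^i,c\in L_\infty(\Omega)$ are given and $$\mathbf{B}[u,v]=\int_\Omega\Big\{\sum_{i,j=1}^d a^{ij}u_{x_i}v_{x_j}+\sum_{i=1}^d b^iu_{x_i}v+cuv\Big\}dx,\qquad u,v\in H^1_0(\Omega).$$ $\mathbf{B}$ satisfies Gårding's inequality: there are $\kappa\ge0$, $\kappa_0>0$ with $\mathbf{B}[\phi,\phi]+\kappa\|\phi\|^2_{L_2(\Omega)}\ge\kappa_0\|\phi\|^2_{H^1_0(\Omega)}$ for all $\phi\in H^1_0(\Omega)$. The operator $A$ on $L_2(\Omega)$ is defined by $\langle -A[\phi],\psi\rangle=\mathbf{B}[\phi,\psi]$ for all $\psi\in H^1_0(\Omega)$, with $\operatorname{dom}(A)$ the set of $\phi\in H^1_0(\Omega)$ for which $\mathbf{B}[\phi,\cdot]$ is represented by an element of $L_2(\Omega)$; $A$ generates a $C_0$-semigroup $S_A(t)$ on $L_2(\Omega)$. For $f\in L_2(\Omega\times(0,t_F))$ and $g\in L_2(\Omega)$, $\underline\theta(t;f,g)=S_A(t)[g]+\int_0^tS_A(t-\tau)[f(\cdot,\tau)]d\tau$. Data: $\beta_{S1},\dots,\beta_{Sm}\in L_2(\Omega)$, $f_S\in L_2(\Omega\times(0,t_F))$, $g,\theta_r\in L_2(\Omega)$; $\theta_{ro}=\theta_r-\underline\theta(t_F;f_S,g)\in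 L_2(\Omega)$. Finite-dimensional objects: $\mathcal{A}_K:X_K\to X_K$ is the linear operator with $\langle\mathcal{A}_K[\phi],\psi\rangle=-\mathbf{B}[\phi,\psi]$ for all $\phi,\psi\in X_K$; $\mathbf{A}_K\in\mathbb{R}^{n_K\times n_K}$ is its matrix in the basis $\{\phi_1,\dots,\phi_{n_K}\}$, i.e. $\{\mathbf{A}_K\}_{k\ell}=-\mathbf{B}[\phi_\ell,\phi_k]$; $S_K(t)=\sum_{\ell\ge0}\mathcal{A}_K^\ell t^\ell/\ell!$; $P_K$ is the orthogonal projection of $L_2(\Omega)$ onto $X_K$; and $$\mathcal{T}_\theta^K[u]=\int_0^{t_F}S_K(t_F-\tau)\Big[P_K\Big[\sum_{i=1}^m\beta_{Si}u_i(\tau)\Big]\Big]d\tau .$$ $(\mathcal{T}_\theta^K)^*:L_2(\Omega)\to L_2(0,t_F)^m$ is the Hilbert-space adjoint. $\mathbf{M}_\beta^K\in\mathbb{R}^{n_K\times m}$ has entries $\{\mathbf{M}_\beta^K\}_{ki}=\langle\beta_{Si},\phi_k\rangle$ and $\mathbf{F}_K(\tau)=(\mathbf{M}_\beta^K)^{\mathrm T}\exp[\mathbf{A}_K^{\mathrm T}(t_F-\tau)]$. *)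

(* Defs.v *)
From HB Require Import structures.
From mathcomp Require Import all_boot all_order all_algebra.
From mathcomp Require Import all_classical all_reals all_analysis.

Set Implicit Arguments.
Unset Strict Implicit.
Unset Printing Implicit Defensive.
Import Order.TTheory GRing.Theory Num.Theory.
Import numFieldNormedType.Exports.

Local Open Scope classical_set_scope.
Local Open Scope ring_scope.

(* Lebesgue measure on R^d: built on d-tuples by iterating the product with the
   one-dimensional Lebesgue measure, then transported to the Borel sigma-algebra
   of the row vectors 'rV[R]_d. *)
Lemma product_sigma_finite d1 d2 (T1 : measurableType d1)
    (T2 : measurableType d2) (R : realType)
    (m1 : {sigma_finite_measure set T1 -> \bar R})
    (m2 : {sigma_finite_measure set T2 -> \bar R}) :
  sigma_finite setT (m1 \x m2)%E.
Proof.
have /sigma_finiteP[F [FT ndF Foo]] := sigma_finiteT m1.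
have /sigma_finiteP[G [GT ndG Goo]] := sigma_finiteT m2.
exists (fun n => F n `*` G n).
  rewrite -setXTT FT GT predeqE => -[x y]; split.
    move=> [/= [n _ Fnx] [k _ Gky]]; exists (maxn n k) => //; split.
    - by move: x Fnx; exact/subsetPset/ndF/leq_maxl.
    - by move: y Gky; exact/subsetPset/ndG/leq_maxr.
  by move=> [n _ []/= ? ?]; split; exists n.
move=> k; have [? ?] := Foo k; have [? ?] := Goo k.
split; first exact: measurableX.
by rewrite product_measure1E// lte_mul_pinfty// ge0_fin_numE.
Qed.

Section lebesgue_tuple.
Context {R : realType}.

Local Notation TR n := (n.-tuple (measurableTypeR R))%type.

Definition tuple_consp n (p : measurableTypeR R * TR n) : TR n.+1 :=
  [the TR n.+1 of p.1 :: p.2].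

Lemma measurable_tuple_consp n : measurable_fun setT (@tuple_consp n).
Proof. exact: measurable_cons. Qed.

Definition tuple_unconsp n (t : TR n.+1) : measurableTypeR R * TR n :=
  (thead t, [tuple of behead t]).

Lemma measurable_tuple_unconsp n : measurable_fun setT (@tuple_unconsp n).
Proof.
apply: measurable_fun_pair; last exact: measurable_behead.
exact: measurable_tnth.
Qed.

Lemma tuple_conspK n : cancel (@tuple_consp n) (@tuple_unconsp n).
Proof.
move=> [x t]; rewrite /tuple_unconsp /tuple_consp/=.
by congr (_, _); apply: val_inj.
Qed.

Section cons_measure.
Variables (n : nat) (mu : {sigma_finite_measure set (TR n) -> \bar R}).

Definition cons_measure : set (TR n.+1) -> \bar R :=
  pushforward (lebesgue_measure \x mu)%E (@tuple_consp n).

HB.instance Definition _ := Measure.copy cons_measure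
  (measure_function_pushforward__canonical__measure_function_Measure
     (lebesgue_measure \x mu)%E (@measurable_tuple_consp n)).

Let cons_measure_sigma_finite : sigma_finite setT cons_measure.
Proof.
have [F FT Ffin] := product_sigma_finite (@lebesgue_measure R) mu.
exists (fun k => @tuple_unconsp n @^-1` F k).
  by rewrite -preimage_bigcup -FT preimage_setT.
move=> k; have [mF Fk] := Ffin k; split.
  by rewrite -[X in measurable X]setTI; exact: measurable_tuple_unconsp.
rewrite /cons_measure /pushforward.
by rewrite (_ : _ @^-1` _ = F k)//; apply/seteqP; split => p;
  rewrite /= tuple_conspK.
Qed.

HB.instance Definition _ := Measure_isSigmaFinite.Build _ _ _ cons_measure
  cons_measure_sigma_finite.

End cons_measure.

Fixpoint lebesgue_tuple n : {sigma_finite_measure set (TR n) -> \bar R} :=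
  match n with
  | 0 => \d_([tuple] : TR 0)
  | n'.+1 => cons_measure (lebesgue_tuple n')
  end.

End lebesgue_tuple.

Notation borelRd R d := (g_sigma_algebraType (@open 'rV[R]_d)).

Section lebesgue_Rd.
Context {R : realType} {d : nat}.

Lemma open_borelRd (O : set 'rV[R]_d) :
  open O -> measurable (O : set (borelRd R d)).
Proof. by move=> oO; exact: sub_sigma_algebra. Qed.

Definition row_of_tuple (t : d.-tuple (measurableTypeR R)) : borelRd R d :=
  \row_i tnth t i.

Lemma measurable_row_of_tuple : measurable_fun setT row_of_tuple.
Proof.
apply: (@measurability _ _ _ _ setT row_of_tuple (@open 'rV[R]_d)) => //.
move=> _ [U oU <-]; rewrite setTI.
pose I := ('rV[rat]_d * nat)%type.
pose c (i : I) : 'rV[R]_d := map_mx ratr i.1.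
pose B (i : I) : set 'rV[R]_d := ball (c i) (i.2.+1%:R^-1).
pose P := [set i : I | B i `<=` U].
have -> : row_of_tuple @^-1` U = \bigcup_(i in P) (row_of_tuple @^-1` (B i)).
  rewrite -preimage_bigcup; congr (_ @^-1` _); apply/seteqP; split; last first.
    by move=> x [i]; exact.
  move=> x Ux.
  have /nbhs_ballP[e /= e0 eU] := open_nbhs_nbhs (conj oU Ux).
  have [k ke] : exists k : nat, k.+1%:R^-1 < e / 2.
    have [k _ kP] := @near_infty_natSinv_lt R (PosNum (divr_gt0 e0 (ltr0n R 2))).
    by exists k; exact: (kP k (leqnn k)).
  have rk i : exists q : rat, `|ratr q - x ord0 i| < k.+1%:R^-1 :> R.
    have xk : x ord0 i < x ord0 i + k.+1%:R^-1 by rewrite ltrDl invr_gt0.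
    have [q] := rat_in_itvoo xk; rewrite in_itv/= => /andP[xq qx]; exists q.
    by rewrite gtr0_norm ?subr_gt0// ltrBlDl.
  have [q qP] := choice rk.
  have xB : B (\row_i (q i), k) x.
    split; first by rewrite /= invr_gt0.
    by move=> i j; rewrite (ord1 i) /ball/= /c/= !mxE; exact: qP.
  exists (\row_i (q i), k) => // y By; apply: eU.
  apply: (@le_ball _ _ _ (k.+1%:R^-1 + k.+1%:R^-1)).
    by rewrite [leRHS]splitr lerD// ltW.
  by apply: ball_triangle By; exact: ball_sym.
have mB i : measurable (row_of_tuple @^-1` B i).
  have -> : row_of_tuple @^-1` B i = \big[setI/setT]_(j < d)
      ((@tnth d (measurableTypeR R))^~ j @^-1` ball (c i ord0 j) i.2.+1%:R^-1).
    rewrite -bigcap_seq; apply/seteqP; split => t.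
      by move=> [_ Bt] j _; have := Bt ord0 j; rewrite [X in ball _ _ X]mxE.
    move=> Bt; split; first by rewrite /= invr_gt0.
    move=> i' j; rewrite (ord1 i') [X in ball _ _ X]mxE.
    apply: (Bt j).
    by rewrite /= mem_index_enum.
  apply: bigsetI_measurable => j _.
  rewrite -[X in measurable X]setTI; apply: measurable_tnth => //.
  by rewrite ball_itv; exact: measurable_itv.
rewrite bigcup_mkcond; apply: countable_bigcupT_measurable.
  exact: countableP.
by move=> i; case: ifPn.
Qed.

Definition lebesgue_Rd : {measure set (borelRd R d) -> \bar R} :=
  measure_function_pushforward__canonical__measure_function_Measure
    (lebesgue_tuple d) measurable_row_of_tuple.

End lebesgue_Rd.

Lemma measurable_tuple_box (R : realType) (d : nat)
    (A : 'I_d -> set (measurableTypeR R)) :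
  (forall i, measurable (A i)) ->
  measurable [set t : d.-tuple (measurableTypeR R) | forall i, A i (tnth t i)].
Proof.
move=> mA.
rewrite (_ : mkset _ = \big[setI/setT]_(j < d)
    ((@tnth d (measurableTypeR R))^~ j @^-1` A j)).
  apply: bigsetI_measurable => j _.
  by rewrite -[X in measurable X]setTI; apply: measurable_tnth.
rewrite -bigcap_seq; apply/seteqP; split => t /= At; first by move=> j _; exact: At.
by move=> j; apply: (At j); rewrite /= mem_index_enum.
Qed.

Lemma lebesgue_tuple_box (R : realType) (d : nat)
    (A : 'I_d -> set (measurableTypeR R)) :
  (forall i, measurable (A i)) ->
  lebesgue_tuple d [set t | forall i, A i (tnth t i)] =
  (\prod_(i < d) lebesgue_measure (A i))%E.
Proof.
elim: d => [|d IH] in A *; move=> mA.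
  by rewrite big_ord0 /= diracE mem_set//= => -[].
rewrite big_ord_recl -IH//= /cons_measure /pushforward.
rewrite -product_measure1E//; last first.
  by apply: (@measurable_tuple_box _ _ (fun i => A (lift ord0 i))) => i; exact: mA.
congr (_ _); apply/seteqP; split => -[x t] /=.
  move=> H; split; first exact: (H ord0).
  by move=> i; have := H (lift ord0 i); rewrite tnthS.
move=> [Ax At] i; case: (unliftP ord0 i) => [j|] ->//.
by rewrite tnthS.
Qed.

Lemma lebesgue_Rd_box (R : realType) (d : nat)
    (A : 'I_d -> set (measurableTypeR R)) :
  (forall i, measurable (A i)) ->
  @lebesgue_Rd R d [set x : 'rV[R]_d | forall i, A i (x ord0 i)] =
  (\prod_(i < d) lebesgue_measure (A i))%E.
Proof.
move=> mA; rewrite -(lebesgue_tuple_box mA).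
rewrite [LHS]/= /pushforward; congr (lebesgue_tuple d _).
by apply/seteqP; split => t /= At i; have := At i; rewrite mxE.
Qed.

(* An element of L2 is a square-integrable function; the equality of L2 is the
   almost everywhere equality L2eq. *)
Notation L2 mu := (LfunType mu (lee1n 2)).
Notation Linf mu := (LfunType mu (leey 1)).

Section L2_inner_product.
Context {disp : measure_display} {T : measurableType disp} {R : realType}.
Variable mu : {measure set T -> \bar R}.

Definition L2dot (f g : L2 mu) : R := \int[mu]_x (f x * g x).

Definition L2norm (f : L2 mu) : R := Num.sqrt (L2dot f f).

Definition L2eq (f g : L2 mu) : Prop := {ae mu, forall x, f x = g x}.

Definition L2cvg (s : nat -> L2 mu) (f : L2 mu) : Prop :=
  L2norm (s k - f) @[k --> \oo] --> 0.

End L2_inner_product.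

(* Bochner integral of an L2-valued function h over a bounded interval D: the
   simple functions s_k converge to h a.e. (strong measurability) and in mean,
   and the integral is the limit of the integrals of the s_k. *)
Section Bochner.
Context {disp : measure_display} {T : measurableType disp} {R : realType}.
Variable mu : {measure set T -> \bar R}.

Record L2simple := MkL2simple {
  ls_size : nat;
  ls_set : 'I_ls_size -> set (measurableTypeR R);
  ls_val : 'I_ls_size -> L2 mu;
  ls_measurable : forall k, measurable (ls_set k) }.

Definition L2simple_fun (s : L2simple) (t : R) : L2 mu :=
  \sum_k \1_(@ls_set s k) t *: ls_val k.

Definition L2simple_int (D : set (measurableTypeR R)) (s : L2simple) : L2 mu :=
  \sum_k fine (lebesgue_measure (D `&` @ls_set s k)) *: ls_val k.

Definition is_bochner (D : set (measurableTypeR R)) (h : R -> L2 mu)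
    (I : L2 mu) : Prop :=
  exists s : nat -> L2simple,
    [/\ {ae (@lebesgue_measure R), forall t, D t ->
          L2cvg (fun k => L2simple_fun (s k) t) (h t)},
        (\int[lebesgue_measure]_(t in D)
           (L2norm (L2simple_fun (s k) t - h t))%:E)%E @[k --> \oo] --> 0%E
      & L2cvg (fun k => L2simple_int D (s k)) I].

Definition bochner (D : set (measurableTypeR R)) (h : R -> L2 mu) : L2 mu :=
  xget 0 (is_bochner D h).

End Bochner.

Section Sobolev.
Context {R : realType} {d : nat} {Omega : set 'rV[R]_d}.
Variable oO : open Omega.

Definition lebesgue_on : {measure set (borelRd R d) -> \bar R} :=
  mrestr lebesgue_Rd (open_borelRd oO).

Definition partial (i : 'I_d) (p : 'rV[R]_d -> R) (x : 'rV[R]_d) : R :=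
  'D_(delta_mx ord0 i) p x.

Fixpoint of_class_C (k : nat) (p : 'rV[R]_d -> R) : Prop :=
  continuous p /\
  if k is k'.+1 then
    forall i : 'I_d, (forall x, derivable p x (delta_mx ord0 i)) /\
      of_class_C k' (partial i p)
  else True.

(* C_c^infty(Omega) *)
Definition test_function (p : 'rV[R]_d -> R) : Prop :=
  (forall k, of_class_C k p) /\
  exists K : set 'rV[R]_d,
    [/\ compact K, K `<=` Omega & forall x, ~ K x -> p x = 0].

(* An element U of H^1 carries its weak gradient: U.1 is the function and
   U.2 i its weak i-th partial derivative (unique up to a.e. equality). *)
Notation H1pair := (L2 lebesgue_on * ('I_d -> L2 lebesgue_on))%type.

Definition weak_partial (i : 'I_d) (u g : L2 lebesgue_on) : Prop :=
  forall p : 'rV[R]_d -> R, test_function p ->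
    \int[lebesgue_on]_x (u x * partial i p x) =
    - \int[lebesgue_on]_x (g x * p x).

Definition H1 : set H1pair := [set U | forall i, weak_partial i U.1 (U.2 i)].

Definition H1norm (U : H1pair) : R :=
  Num.sqrt (L2norm U.1 ^+ 2 + \sum_i L2norm (U.2 i) ^+ 2).

Definition H1eq (U V : H1pair) : Prop :=
  L2eq U.1 V.1 /\ forall i, L2eq (U.2 i) (V.2 i).

(* H^1_0: the closure of C_c^infty(Omega) in H^1 *)
Definition H10 : set H1pair := [set U | H1 U /\
  exists P : nat -> H1pair,
    (forall k, H1 (P k) /\ test_function (P k).1) /\
    H1norm (P k - U) @[k --> \oo] --> 0].

Section elliptic.
Variables (a : 'I_d -> 'I_d -> Linf lebesgue_on) (b : 'I_d -> Linf lebesgue_on)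
  (c : Linf lebesgue_on).

Definition Bform (U V : H1pair) : R :=
  \int[lebesgue_on]_x
    (\sum_i \sum_j a i j x * U.2 i x * V.2 j x
     + \sum_i b i x * U.2 i x * V.1 x
     + c x * U.1 x * V.1 x).

Definition Garding (kappa kappa0 : R) : Prop := forall U, H10 U ->
  Bform U U + kappa * L2norm U.1 ^+ 2 >= kappa0 * H1norm U ^+ 2.

(* the graph of A: opA f h means that f is in dom(A) and A[f] = h *)
Definition opA (f h : L2 lebesgue_on) : Prop :=
  exists U, [/\ H10 U, L2eq U.1 f
    & forall V, H10 V -> L2dot (- h) V.1 = Bform U V].

End elliptic.

Section semigroup.
Variable S : R -> L2 lebesgue_on -> L2 lebesgue_on.

(* linearity and boundedness make S t compatible with L2eq *)
Definition C0_semigroup : Prop :=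
  [/\ forall t, 0 <= t -> forall (r : R) f g,
        L2eq (S t (r *: f + g)) (r *: S t f + S t g),
      forall t, 0 <= t -> exists C : R, forall f,
        L2norm (S t f) <= C * L2norm f,
      forall f, L2eq (S 0 f) f,
      forall s t, 0 <= s -> 0 <= t -> forall f,
        L2eq (S (s + t) f) (S s (S t f))
    & forall f, L2norm (S t f - f) @[t --> 0^'+] --> 0].

Definition generates (A : L2 lebesgue_on -> L2 lebesgue_on -> Prop) : Prop :=
  C0_semigroup /\
  forall f h, A f h <->
    L2norm (t^-1 *: (S t f - f) - h) @[t --> 0^'+] --> 0.

End semigroup.

Variable tF : R.

Definition lebesgue_time : {measure set (measurableTypeR R) -> \bar R} :=
  mrestr (@lebesgue_measure R) (measurable_itv `]0, tF[).

Definition lebesgue_cyl :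
    {measure set (borelRd R d * measurableTypeR R) -> \bar R} :=
  mrestr (lebesgue_Rd \x (@lebesgue_measure R))%E
    (measurableX (open_borelRd oO) (measurable_itv `]0, tF[)).

(* f(., t); it is in L2(Omega) for a.e. t, and set to 0 for the other t *)
Definition slice (f : L2 lebesgue_cyl) (t : R) : L2 lebesgue_on :=
  insubd (0 : L2 lebesgue_on) (fun x => f (x, t)).

Definition mild_solution (S : R -> L2 lebesgue_on -> L2 lebesgue_on) (t : R)
    (f : L2 lebesgue_cyl) (g : L2 lebesgue_on) : L2 lebesgue_on :=
  S t g + bochner `]0, t[ (fun tau => S (t - tau) (slice f tau)).

Section Galerkin.
Variables (a : 'I_d -> 'I_d -> Linf lebesgue_on) (b : 'I_d -> Linf lebesgue_on)
  (c : Linf lebesgue_on).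
Variable XK : set H1pair.
Variables (m : nat) (beta : 'I_m -> L2 lebesgue_on).

(* xget picks one representative: the defining properties determine the objects
   below only up to a.e. equality. *)
Definition opAK (U : H1pair) : H1pair :=
  xget 0 [set W | XK W /\
    forall V, XK V -> L2dot W.1 V.1 = - Bform a b c U V].

Definition SK (t : R) (U : H1pair) : H1pair :=
  xget 0 [set W | XK W /\
    L2cvg (fun N => (\sum_(l < N) (t ^+ l / l`!%:R) *: iter l opAK U).1) W.1].

Definition PK (f : L2 lebesgue_on) : H1pair :=
  xget 0 [set W | XK W /\ forall V, XK V -> L2dot (f - W.1) V.1 = 0].

Definition TK (u : 'I_m -> L2 lebesgue_time) : L2 lebesgue_on :=
  bochner `]0, tF[
    (fun tau => (SK (tF - tau) (PK (\sum_i u i tau *: beta i))).1).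

End Galerkin.

Definition adjoint (m : nat) (T : ('I_m -> L2 lebesgue_time) -> L2 lebesgue_on)
    (theta : L2 lebesgue_on) : 'I_m -> L2 lebesgue_time :=
  xget 0 [set w | forall u, L2dot (T u) theta = \sum_i L2dot (u i) (w i)].

End Sobolev.

Notation H1pair d oO := (L2 (lebesgue_on oO) * ('I_d -> L2 (lebesgue_on oO)))%type.

Definition spanned_by (R : realType) (d : nat) (Omega : set 'rV[R]_d)
    (oO : open Omega) (n : nat) (phi : 'I_n -> H1pair d oO) : set (H1pair d oO) :=
  [set U | exists k : 'I_n -> R, H1eq U (\sum_l k l *: phi l)].

Definition L2orthonormal (R : realType) (d : nat) (Omega : set 'rV[R]_d)
    (oO : open Omega) (n : nat) (phi : 'I_n -> H1pair d oO) : Prop :=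
  forall k l, L2dot (phi k).1 (phi l).1 = (k == l)%:R.

Section matrices.
Context {R : realType}.

(* exp(M), as the entrywise sum of the exponential series *)
Definition mexp (n : nat) (M : 'M[R]_n) : 'M[R]_n :=
  \matrix_(i, j)
    limn (fun N => (\sum_(l < N) (l`!%:R)^-1 *: M ^+ l : 'M[R]_n) i j).

Context {d : nat} {Omega : set 'rV[R]_d}.
Variables (oO : open Omega) (tF : R).
Variables (a : 'I_d -> 'I_d -> Linf (lebesgue_on oO))
  (b : 'I_d -> Linf (lebesgue_on oO)) (c : Linf (lebesgue_on oO)).
Variables (n : nat) (phi : 'I_n -> H1pair d oO).
Variables (m : nat) (beta : 'I_m -> L2 (lebesgue_on oO)).

Definition mxAK : 'M[R]_n := \matrix_(k, l) - Bform a b c (phi l) (phi k).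

Definition mxMbeta : 'M[R]_(n, m) := \matrix_(k, i) L2dot (beta i) (phi k).1.

Definition mxF (tau : R) : 'M[R]_(m, n) :=
  mxMbeta^T *m mexp ((tF - tau) *: mxAK^T).

Definition mxG : 'M[R]_n := \matrix_(k, l)
  \int[lebesgue_measure]_(tau in `[0, tF]) ((mxF tau)^T *m mxF tau) k l.

Definition vec_theta (theta : L2 (lebesgue_on oO)) : 'cV[R]_n :=
  \col_k L2dot (phi k).1 theta.

End matrices.

(* Main.v *)
(* In the coordinates of the orthonormal basis phi, the discrete control map is
   u |-> y(u) := int_0^tF F(tau)^T u(tau) dtau, so its adjoint sends theta to
   F(.) v with v_k = <phi_k, theta>, and y(F(.) v) = G v with G the Gram matrix of the
   columns of F.  The equation becomes rho u = F(.) (v - y(u)), which determines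
   u from v - y(u); applying y gives (rho + G) (v - y(u)) = rho v, and rho + G is
   invertible because G is positive semidefinite.

   The operators and integrals of the definitions are arbitrary representatives
   chosen by xget, so each of them is only accessed through inner products: a
   Bochner integral with values in the span of phi is determined up to a.e.
   equality by the integrals of its coordinates. *)
Require Import Defs.
From HB Require Import structures.
From mathcomp Require Import all_boot all_order all_algebra.
From mathcomp Require Import all_classical all_reals all_analysis.
From mathcomp Require Import finmap ess_sup_inf measurable_realfun ring.

Set Implicit Arguments.
Unset Strict Implicit.
Unset Printing Implicit Defensive.
Import Order.TTheory GRing.Theory Num.Theory.
Import numFieldNormedType.Exports HBSimple.

Local Open Scope classical_set_scope.
Local Open Scope ring_scope.

(** * Inner product and a.e. equality on L2 *)

Section L2_theory.
Context {disp : measure_display} {T : measurableType disp} {R : realType}.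
Variable mu : {measure set T -> \bar R}.
Implicit Types f g h : L2 mu.

Lemma L2DE f g x : (f + g) x = f x + g x. Proof. by []. Qed.
Lemma L2NE f x : (- f) x = - f x. Proof. by []. Qed.
Lemma L2ZE (r : R) f x : (r *: f) x = r * f x. Proof. by []. Qed.
Lemma L20E x : (0 : L2 mu) x = 0. Proof. by []. Qed.

Lemma L2_sumE (I : Type) (s : seq I) (F : I -> L2 mu) x :
  (\sum_(i <- s) F i) x = \sum_(i <- s) F i x.
Proof. by elim/big_rec2: _ => // i y z _ <-. Qed.

Lemma measurable_L2 f : measurable_fun setT (f : T -> R).
Proof. exact: measurable_funP. Qed.

Lemma L2_integrableM f g : mu.-integrable setT (EFin \o (fun x => f x * g x)).
Proof. by apply/Lfun1_integrable; apply: Lfun2_mul_Lfun1; exact: LfunP. Qed.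

Lemma L2dotC f g : L2dot f g = L2dot g f.
Proof. by apply: eq_Rintegral => x _; rewrite mulrC. Qed.

Lemma L2dotDl f g h : L2dot (f + g) h = L2dot f h + L2dot g h.
Proof.
rewrite /L2dot -RintegralD//; try exact: L2_integrableM.
by apply: eq_Rintegral => x _; rewrite L2DE mulrDl.
Qed.

Lemma L2dotZl r f g : L2dot (r *: f) g = r * L2dot f g.
Proof.
rewrite /L2dot -RintegralZl//; try exact: L2_integrableM.
by apply: eq_Rintegral => x _; rewrite L2ZE mulrA.
Qed.

Lemma L2dotNl f g : L2dot (- f) g = - L2dot f g.
Proof. by rewrite -scaleN1r L2dotZl mulN1r. Qed.

Lemma L2dotBl f g h : L2dot (f - g) h = L2dot f h - L2dot g h.
Proof. by rewrite L2dotDl L2dotNl. Qed.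

Lemma L2dotDr f g h : L2dot h (f + g) = L2dot h f + L2dot h g.
Proof. by rewrite !(L2dotC h) L2dotDl. Qed.

Lemma L2dotZr r f g : L2dot f (r *: g) = r * L2dot f g.
Proof. by rewrite !(L2dotC f) L2dotZl. Qed.

Lemma L2dotBr f g h : L2dot h (f - g) = L2dot h f - L2dot h g.
Proof. by rewrite !(L2dotC h) L2dotBl. Qed.

Lemma L2dot0l f : L2dot 0 f = 0.
Proof. by rewrite -(scale0r f) L2dotZl mul0r. Qed.

Lemma L2dot_suml (I : Type) (s : seq I) (F : I -> L2 mu) g :
  L2dot (\sum_(i <- s) F i) g = \sum_(i <- s) L2dot (F i) g.
Proof.
elim: s => [|i s IH]; first by rewrite !big_nil L2dot0l.
by rewrite !big_cons L2dotDl IH.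
Qed.

Lemma L2dot_sumr (I : Type) (s : seq I) (F : I -> L2 mu) g :
  L2dot g (\sum_(i <- s) F i) = \sum_(i <- s) L2dot g (F i).
Proof. by rewrite L2dotC L2dot_suml; apply: eq_bigr => i _; rewrite L2dotC. Qed.

Lemma L2dot_ge0 f : 0 <= L2dot f f.
Proof. by apply: Rintegral_ge0 => x _; rewrite -expr2 sqr_ge0. Qed.

Lemma L2eq_refl f : L2eq f f. Proof. exact/aeW. Qed.

Lemma L2eq_sym f g : L2eq f g -> L2eq g f.
Proof. by apply: filterS => x ->. Qed.

Lemma L2eq_trans f g h : L2eq f g -> L2eq g h -> L2eq f h.
Proof. by apply: filterS2 => x -> ->. Qed.

Lemma L2eqD f f' g g' : L2eq f f' -> L2eq g g' -> L2eq (f + g) (f' + g').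
Proof. by apply: filterS2 => x fx gx; rewrite !L2DE fx gx. Qed.

Lemma L2eqZ r f f' : L2eq f f' -> L2eq (r *: f) (r *: f').
Proof. by apply: filterS => x fx; rewrite !L2ZE fx. Qed.

Lemma L2eqB f f' g g' : L2eq f f' -> L2eq g g' -> L2eq (f - g) (f' - g').
Proof. by apply: filterS2 => x fx gx; rewrite !L2DE !L2NE fx gx. Qed.

Lemma ae_eq_Rintegral (D : set T) (p q : T -> R) : measurable D ->
  measurable_fun D p -> measurable_fun D q ->
  {ae mu, forall x, D x -> p x = q x} ->
  \int[mu]_(x in D) p x = \int[mu]_(x in D) q x.
Proof.
move=> mD mp mq pq; congr fine; apply: ae_eq_integral => //.
- exact/measurable_EFinP.
- exact/measurable_EFinP.
- by apply: filterS pq => x pq Dx; rewrite pq.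
Qed.

Lemma L2dot_eql f f' g : L2eq f f' -> L2dot f g = L2dot f' g.
Proof.
move=> ff'; apply: ae_eq_Rintegral => //.
- by apply: measurable_funM; exact: measurable_L2.
- by apply: measurable_funM; exact: measurable_L2.
- by apply: filterS ff' => x -> _.
Qed.

Lemma L2dot_eqr f f' g : L2eq f f' -> L2dot g f = L2dot g f'.
Proof. by move=> ff'; rewrite !(L2dotC g); exact: L2dot_eql. Qed.

Lemma L2norm_eq f f' : L2eq f f' -> L2norm f = L2norm f'.
Proof. by move=> ff'; rewrite /L2norm (L2dot_eql _ ff') (L2dot_eqr _ ff'). Qed.

(** A nonnegative function with zero integral vanishes almost everywhere; here the function is
    [f * f]. *)
Lemma L2dot_eq0 f : L2dot f f = 0 -> L2eq f 0.
Proof.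
move=> f0.
have fi := L2_integrableM f f.
have : (\int[mu]_x `|(f x * f x)%:E| = 0)%E.
  under eq_integral do rewrite gee0_abs ?lee_fin -?expr2 ?sqr_ge0//.
  have := integrable_fin_num measurableT fi.
  by move=> /fineK <-; rewrite [fine _]f0.
move/(ae_eq_integral_abs mu measurableT (measurable_int _ fi)).
apply: filterS => x /(_ Logic.I)/= [] /eqP.
by rewrite mulf_eq0 orbb => /eqP.
Qed.

(** For the converse, testing against [f - g] gives [f - g] zero norm. This is how an object known
    only through inner products is identified. *)
Lemma L2eqP f g : L2eq f g <-> (forall h, L2dot f h = L2dot g h).
Proof.
split=> [fg h|fg]; first exact: L2dot_eql.
have /L2dot_eq0 : L2dot (f - g) (f - g) = 0 by rewrite L2dotBl fg subrr.
by apply: filterS => x /eqP; rewrite L2DE L2NE L20E subr_eq0 => /eqP.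
Qed.

Lemma L2norm_ge0 f : 0 <= L2norm f. Proof. exact: sqrtr_ge0. Qed.

Lemma L2normK f : L2norm f ^+ 2 = L2dot f f.
Proof. by rewrite sqr_sqrtr// L2dot_ge0. Qed.

(** Cauchy-Schwarz: when [g] has nonzero norm, expand the squared norm of [f] minus its projection
    onto [g], which is nonnegative. *)
Lemma L2dot_le_norm f g : `|L2dot f g| <= L2norm f * L2norm g.
Proof.
have [g0|g0] := eqVneq (L2dot g g) 0.
  rewrite (L2dot_eqr _ (L2dot_eq0 g0)) L2dotC L2dot0l normr0.
  by rewrite mulr_ge0 ?L2norm_ge0.
rewrite -ler_sqr ?nnegrE ?mulr_ge0 ?L2norm_ge0//.
rewrite exprMn !L2normK real_normK ?num_real//.
have gpos : 0 < L2dot g g by rewrite lt_neqAle eq_sym g0 L2dot_ge0.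
have := L2dot_ge0 (f - (L2dot f g / L2dot g g) *: g).
rewrite !(L2dotBl, L2dotBr) !(L2dotZl, L2dotZr) (L2dotC g f) => H.
rewrite -subr_ge0; have -> : L2dot f f * L2dot g g - L2dot f g ^+ 2 = L2dot g g *
   (L2dot f f - L2dot f g / L2dot g g * L2dot f g -
   (L2dot f g / L2dot g g * L2dot f g -
    L2dot f g / L2dot g g * (L2dot f g / L2dot g g * L2dot g g))) by field.
by rewrite pmulr_rge0.
Qed.

(** Strong convergence implies weak convergence, by Cauchy-Schwarz. Limits in [L2cvg] are only ever
    identified through this weak form. *)
Lemma L2cvg_dot (s : nat -> L2 mu) f h : L2cvg s f ->
  L2dot (s k) h @[k --> \oo] --> L2dot f h.
Proof.
move=> sf; apply/subr_cvg0; apply/norm_cvg0P.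
apply: (@squeeze_cvgr _ _ _ _ (cst 0) (fun k => L2norm (s k - f) * L2norm h)).
- by near=> k; rewrite normr_ge0/= -L2dotBl L2dot_le_norm.
- exact: cvg_cst.
- by rewrite -(mul0r (L2norm h)); apply: cvgMl.
Unshelve. all: by end_near. Qed.

End L2_theory.

(** * Matrix exponential *)

Section matrix_exponential.
Context {R : realType} {n : nat}.
Implicit Types M : 'M[R]_n.

(** The entrywise [l1] norm, used to compare the matrix exponential series entry by entry with the
    scalar one. *)
Definition mx_abs_sum M : R := \sum_i \sum_j `|M i j|.

Lemma mx_abs_sum_ge0 M : 0 <= mx_abs_sum M.
Proof. by apply: sumr_ge0 => i _; apply: sumr_ge0. Qed.

Lemma mx_abs_sumZ (r : R) M : mx_abs_sum (r *: M) = `|r| * mx_abs_sum M.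
Proof.
rewrite /mx_abs_sum mulr_sumr; apply: eq_bigr => i _.
by rewrite mulr_sumr; apply: eq_bigr => j _; rewrite mxE normrM.
Qed.

(** Induction on [l]: an entry of [M * M ^+ l] is at most the absolute sum of row [i] of [M] times
    the bound for [M ^+ l], and one row sum is at most the full sum. *)
Lemma normr_expmx_le M l i j : `|(M ^+ l) i j| <= mx_abs_sum M ^+ l.
Proof.
elim: l i j => [|l IH] i j.
  by rewrite !expr0 mxE; case: eqP => _; rewrite ?normr1// normr0.
rewrite exprS [M * _]/(M *m _) mxE (le_trans (ler_norm_sum _ _ _))//.
apply: (@le_trans _ _ (\sum_k `|M i k| * mx_abs_sum M ^+ l)).
  by apply: ler_sum => k _; rewrite normrM ler_wpM2l.
rewrite -mulr_suml exprS ler_wpM2r ?exprn_ge0 ?mx_abs_sum_ge0//.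
rewrite /mx_abs_sum [leRHS](bigD1 i)//= lerDl.
by apply: sumr_ge0 => k _; apply: sumr_ge0.
Qed.

Definition mexp_partial M (N : nat) : 'M[R]_n :=
  \sum_(l < N) (l`!%:R)^-1 *: M ^+ l.

Lemma mexp_partialE M i j : (fun N => mexp_partial M N i j) =
  series (fun l => (l`!%:R)^-1 * (M ^+ l) i j).
Proof.
apply/funext => N; rewrite /mexp_partial summxE /series /= big_mkord.
by apply: eq_bigr => l _; rewrite mxE.
Qed.

Lemma normr_mexp_term_le M i j l :
  `|(l`!%:R)^-1 * (M ^+ l) i j| <= exp_coeff (mx_abs_sum M) l.
Proof.
rewrite /exp_coeff /= normrM normfV normr_nat mulrC ler_wpM2r ?invr_ge0//.
exact: normr_expmx_le.
Qed.

(** Comparison with the series of [expR (mx_abs_sum M)]. It ensures that the [limn] in [mexp] is a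
    genuine limit and not a default value. *)
Lemma is_cvg_mexp_partial M i j : cvgn (fun N => mexp_partial M N i j).
Proof.
rewrite mexp_partialE; apply: normed_cvg.
apply: (@series_le_cvg _ _ (exp_coeff (mx_abs_sum M))) => [l|l|l|] /=.
- exact: normr_ge0.
- by apply: exp_coeff_ge0; exact: mx_abs_sum_ge0.
- exact: normr_mexp_term_le.
- exact: is_cvg_series_exp_coeff.
Qed.

Lemma cvg_mexp M i j :
  (fun N => mexp_partial M N i j) @ \oo --> mexp M i j.
Proof. by rewrite /mexp mxE; exact: is_cvg_mexp_partial. Qed.

(** Each partial sum is bounded by a partial sum of a nonnegative scalar series, hence by its limit.
    The bound later makes [mxF] bounded, so square integrable, in time. *)
Lemma normr_mexp_le M i j : `|mexp M i j| <= expR (mx_abs_sum M).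
Proof.
have /cvg_norm ec := @cvg_mexp M i j.
rewrite -(cvg_lim _ ec)//; apply: limr_le; first by apply/cvg_ex; eexists; exact: ec.
near=> N.
have -> : mexp_partial M N i j = series (fun l => (l`!%:R)^-1 * (M ^+ l) i j) N.
  by rewrite -mexp_partialE.
rewrite (le_trans (ler_norm_sum _ _ _))//.
apply: (@le_trans _ _ (series (exp_coeff (mx_abs_sum M)) N)).
  by apply: ler_sum => l _; exact: normr_mexp_term_le.
apply: nondecreasing_cvgn_le; last exact: is_cvg_series_exp_coeff.
apply/nondecreasing_seqP => k.
by rewrite /series /= big_nat_recr//= lerDl exp_coeff_ge0// mx_abs_sum_ge0.
Unshelve. all: by end_near. Qed.

Lemma tr_expmx M l : (M ^+ l)^T = M^T ^+ l.
Proof.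
elim: l => [|l IH]; first by rewrite !expr0 trmx1.
by rewrite exprS exprSr trmx_mul IH.
Qed.

(** Transposition commutes with each partial sum. It reconciles [mxF], written with the transpose of
    [mxAK], with the semigroup [SK], which produces [mxAK] itself. *)
Lemma tr_mexp M : (mexp M)^T = mexp M^T.
Proof.
apply/matrixP => i j; rewrite !mxE; congr (lim (_ @ \oo)).
apply/funext => N; rewrite !summxE; apply: eq_bigr => l _.
by rewrite -tr_expmx !mxE.
Qed.

Lemma expmxZ (r : R) M l : (r *: M) ^+ l = r ^+ l *: M ^+ l.
Proof.
elim: l => [|l IH]; first by rewrite !expr0 scale1r.
by rewrite !exprS IH -!mulmxE -scalemxAl -scalemxAr scalerA.
Qed.

Lemma mexp_partialZ (r : R) M N :
  mexp_partial (r *: M) N = \sum_(l < N) (r ^+ l / l`!%:R) *: M ^+ l.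
Proof. by apply: eq_bigr => l _; rewrite expmxZ scalerA mulrC. Qed.

(** The partial sums are polynomials in [g t], and pointwise limits preserve measurability. *)
Lemma measurable_mexp (g : R -> R) M i j : measurable_fun setT g ->
  measurable_fun setT (fun t => mexp (g t *: M) i j).
Proof.
move=> mg; apply: (@measurable_fun_cvg _ _ _ _
  (fun N t => mexp_partial (g t *: M) N i j)) => [N|t _]; last exact: cvg_mexp.
under eq_fun do rewrite mexp_partialZ summxE.
apply: measurable_sum => l.
under eq_fun do rewrite mxE.
apply: measurable_funM => //; apply: measurable_funM => //.
exact: measurable_funX.
Qed.

End matrix_exponential.

(** * Integration against the restriction of a measure to a measurable set *)

Section measure_restriction.
Context {disp : measure_display} {T : measurableType disp} {R : realType}.
Variable mu : {measure set T -> \bar R}.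
Variables (D : set T) (mD : measurable D).

Let nu : {measure set T -> \bar R} := mrestr mu mD.

Let nu_setC : nu (~` D) = 0%E.
Proof. by rewrite /nu/= /mrestr setICl measure0. Qed.

Let nu_mu (A : set T) : measurable A -> A `<=` D -> nu A = mu A.
Proof. by move=> _ AD; rewrite /nu/= /mrestr setIidl. Qed.

(** The complement of [D] is negligible for [nu], and [nu] agrees with [mu] on subsets of [D]. *)
Lemma ge0_integral_mrestr (f : T -> \bar R) : measurable_fun setT f ->
  (forall x, 0 <= f x)%E -> (\int[nu]_x f x = \int[mu]_(x in D) f x)%E.
Proof.
move=> mf f0; rewrite (@ge0_negligible_integral _ _ _ nu setT (~` D))//.
  by rewrite setTD setCK; exact: eq_measure_integral.
exact: measurableC.
Qed.

Lemma integrable_mrestr (f : T -> \bar R) : measurable_fun setT f ->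
  nu.-integrable setT f <-> mu.-integrable D f.
Proof.
move=> mf; have I : (\int[nu]_x `|f x| = \int[mu]_(x in D) `|f x|)%E.
  by apply: ge0_integral_mrestr => //; exact: measurableT_comp.
split => /integrableP[_ fi]; apply/integrableP; split => //.
- exact: measurable_funTS.
- by rewrite -I.
- by rewrite I.
Qed.

Lemma Rintegral_mrestr (f : T -> R) : nu.-integrable setT (EFin \o f) ->
  \int[nu]_x f x = \int[mu]_(x in D) f x.
Proof.
move=> fi; congr fine.
rewrite (@negligible_integral _ _ _ nu setT (~` D))//; last exact: measurableC.
by rewrite setTD setCK; exact: eq_measure_integral.
Qed.

Lemma bounded_Lfun2_mrestr (f : T -> R) (C : R) : (mu D < +oo)%E ->
  measurable_fun setT f -> (forall x, D x -> `|f x| <= C) ->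
  f \in Lfun nu 2%:E.
Proof.
move=> muD mf fC; apply/andP; split; apply: mem_set => //=.
rewrite /finite_norm unlock; apply: poweR_lty => /=.
have mf2 : measurable_fun setT (fun x => (`|f x| `^ 2)%:E).
  apply/measurable_EFinP; apply: (measurableT_comp (measurable_powR _)) => //.
  exact: measurableT_comp.
rewrite ge0_integral_mrestr//.
apply: (@le_lt_trans _ _ (\int[mu]_(x in D) (C ^+ 2)%:E)%E).
  apply: ge0_le_integral => //.
  - exact: measurable_funTS.
  - move=> x Dx; have fCx := fC _ Dx.
    by rewrite lee_fin powR_mulrn// ler_sqr ?nnegrE// (le_trans _ fCx).
by rewrite integral_cst//= lte_mul_pinfty// lee_fin sqr_ge0.
Qed.

End measure_restriction.

(** * Regularized least squares with finite rank *)

Section gram.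
Context {disp : measure_display} {T : measurableType disp} {R : realType}.
Variable mu : {measure set T -> \bar R}.
Variables (m n : nat) (FL : 'I_m -> 'I_n -> L2 mu).
Implicit Types (u : 'I_m -> L2 mu) (v : 'cV[R]_n).

(** With [FL] the entries of [F], this is the control [F(.) v]; [analysis] below is its adjoint, the
    integral of [F^T u]. *)
Definition synthesis v (i : 'I_m) : L2 mu := \sum_k v k ord0 *: FL i k.

Definition analysis u : 'cV[R]_n := \col_k \sum_i L2dot (FL i k) (u i).

Definition gram : 'M[R]_n := \matrix_(k, l) \sum_i L2dot (FL i k) (FL i l).

Lemma synthesisD v w i : synthesis (v + w) i = synthesis v i + synthesis w i.
Proof.
by rewrite /synthesis -big_split; apply: eq_bigr => k _; rewrite mxE scalerDl.
Qed.

Lemma synthesisZ r v i : synthesis (r *: v) i = r *: synthesis v i.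
Proof.
by rewrite /synthesis scaler_sumr; apply: eq_bigr => k _; rewrite mxE scalerA.
Qed.

Lemma synthesis0 i : synthesis 0 i = 0.
Proof. by rewrite -(scale0r 0) synthesisZ scale0r. Qed.

Lemma synthesisN v i : synthesis (- v) i = - synthesis v i.
Proof. by rewrite -scaleN1r synthesisZ scaleN1r. Qed.

Lemma analysis_synthesis v : analysis (synthesis v) = gram *m v.
Proof.
apply/colP => k; rewrite !mxE.
under eq_bigr do rewrite L2dot_sumr.
rewrite exchange_big; apply: eq_bigr => l _; rewrite mxE mulr_suml.
by apply: eq_bigr => i _; rewrite L2dotZr mulrC.
Qed.

Lemma dot_synthesis v u :
  \sum_i L2dot (u i) (synthesis v i) = \sum_k v k ord0 * analysis u k ord0.
Proof.
under eq_bigr do rewrite L2dot_sumr.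
rewrite exchange_big; apply: eq_bigr => k _; rewrite mxE mulr_sumr.
by apply: eq_bigr => i _; rewrite L2dotZr L2dotC.
Qed.

Lemma analysis_eq u u' : (forall i, L2eq (u i) (u' i)) -> analysis u = analysis u'.
Proof.
by move=> uu'; apply/colP => k; rewrite !mxE; apply: eq_bigr => i _; exact: L2dot_eqr.
Qed.

Lemma analysisZ r u : analysis (fun i => r *: u i) = r *: analysis u.
Proof.
by apply/colP => k; rewrite !mxE mulr_sumr; apply: eq_bigr => i _; rewrite L2dotZr.
Qed.

Variables (rho : R) (rho_gt0 : 0 < rho).

(** A row vector [w] in the left kernel satisfies [0 = rho |w|^2 + sum_i |synthesis w^T i|^2]. Both
    terms are nonnegative and [rho > 0], so [w = 0]. *)
Lemma regularized_gram_unitmx : rho%:M + gram \in unitmx.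
Proof.
rewrite unitmxE unitfE; apply/negP => /det0P[w w0 wG].
have : (w *m (rho%:M + gram) *m w^T) ord0 ord0 = 0 by rewrite wG mul0mx mxE.
rewrite mulmxDr mulmxDl mul_mx_scalar -mulmxA -analysis_synthesis mxE.
have -> : (w *m analysis (synthesis w^T)) ord0 ord0 =
    \sum_i L2dot (synthesis w^T i) (synthesis w^T i).
  by rewrite dot_synthesis mxE; apply: eq_bigr => k _; rewrite [w^T _ _]mxE.
have -> : (rho *: w *m w^T) ord0 ord0 = rho * \sum_k w ord0 k ^+ 2.
  by rewrite mxE mulr_sumr; apply: eq_bigr => k _; rewrite !mxE expr2 mulrA.
have w2_ge0 : 0 <= rho * \sum_k w ord0 k ^+ 2.
  apply: mulr_ge0; first exact: ltW.
  by apply: sumr_ge0 => k _; exact: sqr_ge0.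
have s2_ge0 : 0 <= \sum_i L2dot (synthesis w^T i) (synthesis w^T i).
  by apply: sumr_ge0 => i _; exact: L2dot_ge0.
move=> /eqP; rewrite paddr_eq0//.
rewrite mulf_eq0 gt_eqF//= => /andP[+ _].
rewrite psumr_eq0; last by move=> k _; exact: sqr_ge0.
move=> /allP ws.
move/negP: w0; apply; apply/eqP/rowP => k; rewrite mxE.
by have := ws k (mem_index_enum k); rewrite sqrf_eq0 => /eqP.
Qed.

Variable theta : 'cV[R]_n.
Let v := invmx (rho%:M + gram) *m theta.

Let v_eq : rho *: v + gram *m v = theta.
Proof.
by rewrite -mul_scalar_mx -mulmxDl mulKVmx// regularized_gram_unitmx.
Qed.

(** By linearity the left-hand side is the synthesis of [rho v + G v - theta], which is zero by the
    choice of [v]. *)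
Lemma synthesis_solves i : L2eq (rho *: synthesis v i +
  synthesis (analysis (synthesis v) - theta) i) 0.
Proof.
rewrite analysis_synthesis -synthesisZ -synthesisD addrA v_eq subrr synthesis0.
exact: L2eq_refl.
Qed.

Lemma solution_synthesis u :
  (forall i, L2eq (rho *: u i + synthesis (analysis u - theta) i) 0) ->
  forall i, L2eq (u i) (synthesis v i).
Proof.
move=> su; have ru i : L2eq (rho *: u i) (synthesis (theta - analysis u) i).
  apply: filterS (su i) => x; rewrite L2DE L20E => /eqP.
  by rewrite addr_eq0 -L2NE -synthesisN opprB => /eqP.
(* Applying [analysis] to [ru] gives [rho (analysis u) = G (theta - analysis u)]. Hence [rho + G]
   sends both sides to [rho theta], and it is injective. *)
have tv : theta - analysis u = rho *: v.
  apply: (can_inj (mulKmx regularized_gram_unitmx)).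
  have := analysis_eq ru; rewrite analysisZ analysis_synthesis => rS.
  rewrite mulmxDl -rS mul_scalar_mx -scalerDr subrK.
  by rewrite -scalemxAr mulmxDl mul_scalar_mx v_eq.
move=> i; apply: filterS (ru i) => x.
by rewrite tv synthesisZ !L2ZE => /(mulfI (lt0r_neq0 rho_gt0)).
Qed.

End gram.

(** * Bochner integral of a function with values in a finite-dimensional span *)

Section orthonormal_family.
Context {disp : measure_display} {T : measurableType disp} {R : realType}.
Variable mu : {measure set T -> \bar R}.
Variables (n : nat) (e : 'I_n -> L2 mu).
Hypothesis e_orthonormal : forall k l, L2dot (e k) (e l) = (k == l)%:R.

Definition comb (c : 'I_n -> R) : L2 mu := \sum_l c l *: e l.

Lemma combB (c c' : 'I_n -> R) : comb c - comb c' = comb (fun l => c l - c' l).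
Proof. by rewrite /comb -sumrB; apply: eq_bigr => l _; rewrite scalerBl. Qed.

Lemma L2dot_comb (c : 'I_n -> R) (f : L2 mu) :
  L2dot (comb c) f = \sum_l c l * L2dot (e l) f.
Proof. by rewrite L2dot_suml; apply: eq_bigr => l _; rewrite L2dotZl. Qed.

Lemma L2dot_comb_coord (c : 'I_n -> R) k : L2dot (comb c) (e k) = c k.
Proof.
rewrite L2dot_comb (bigD1 k)//= e_orthonormal eqxx mulr1 big1 ?addr0// => l lk.
by rewrite e_orthonormal (negPf lk) mulr0.
Qed.

(** The squared norm is the sum of the [c_l^2], at most the square of the sum of the [|c_l|]. This
    [l1] bound is linear in the coordinates, so it can be integrated term by term. *)
Lemma L2norm_comb_le (c : 'I_n -> R) : L2norm (comb c) <= \sum_l `|c l|.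
Proof.
have s0 : 0 <= \sum_l `|c l| by exact: sumr_ge0.
rewrite -ler_sqr ?nnegrE ?L2norm_ge0// L2normK L2dot_comb expr2 mulr_suml.
apply: ler_sum => l _; rewrite L2dotC L2dot_comb_coord.
rewrite (le_trans (ler_norm _))// normrM ler_wpM2l// (bigD1 l)//= lerDl.
exact: sumr_ge0.
Qed.

Lemma L2cvg_comb (s : nat -> L2 mu) (f : L2 mu) (c : nat -> 'I_n -> R)
    (c' : 'I_n -> R) :
  (forall k, L2eq (s k) (comb (c k))) -> L2eq f (comb c') ->
  (forall l, c k l @[k --> \oo] --> c' l) -> L2cvg s f.
Proof.
move=> sc fc cc'.
apply: (@squeeze_cvgr _ _ _ _ (cst 0) (fun k => \sum_l `|c k l - c' l|)).
- near=> k; rewrite L2norm_ge0/= (L2norm_eq (L2eqB (sc k) fc)) combB.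
  exact: L2norm_comb_le.
- exact: cvg_cst.
- rewrite [X in _ --> X](_ : _ = \sum_(l < n) `|c' l - c' l|); last first.
    by rewrite big1// => l _; rewrite subrr normr0.
  apply: cvg_big => [|l _]; first exact: add_continuous.
  by apply: cvg_norm; apply: cvgB => //; exact: cvg_cst.
Unshelve. all: by end_near. Qed.

(** The candidate for the Bochner integral of the function with coordinates [q]. *)
Definition comb_int (D : set (measurableTypeR R)) (q : 'I_n -> R -> R) : L2 mu :=
  comb (fun l => \int[lebesgue_measure]_(t in D) q l t).

(** * Simple functions with values in the span *)

Section simple_functions_in_span.
Variable D : set (measurableTypeR R).

Lemma L2dot_simple_fun (s : L2simple mu) t (f : L2 mu) :
  L2dot (L2simple_fun s t) f =
  \sum_k \1_(ls_set k) t * L2dot (@ls_val _ _ _ _ s k) f.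
Proof. by rewrite L2dot_suml; apply: eq_bigr => k _; rewrite L2dotZl. Qed.

Lemma measurable_dot_sum (m1 m2 : nat) (p : 'I_m1 -> R -> R) (q : 'I_m2 -> R -> R)
    (f : 'I_m1 -> L2 mu) (g : 'I_m2 -> L2 mu) :
  (forall i, measurable_fun D (p i)) -> (forall j, measurable_fun D (q j)) ->
  measurable_fun D
    (fun t => L2dot (\sum_i p i t *: f i) (\sum_j q j t *: g j)).
Proof.
move=> mp mq; under eq_fun do rewrite L2dot_suml.
apply: measurable_sum => i; under eq_fun do rewrite L2dotZl.
apply: measurable_funM => //; under eq_fun do rewrite L2dot_sumr.
apply: measurable_sum => j; under eq_fun do rewrite L2dotZr.
by apply: measurable_funM.
Qed.

(** The squared norm expands into finite sums of products of measurable scalar functions with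
    constant inner products. *)
Lemma measurable_norm_simple_sub (s : L2simple mu) (q : 'I_n -> R -> R) :
  (forall l, measurable_fun D (q l)) ->
  measurable_fun D (fun t => L2norm (L2simple_fun s t - comb (q ^~ t))).
Proof.
move=> mq; have ms : measurable_fun setT (@Num.sqrt R).
  by apply: continuous_measurable_fun; exact: sqrt_continuous.
rewrite /L2norm.
apply: (measurableT_comp ms).
under eq_fun do rewrite L2dotBl !L2dotBr.
have m1 k : measurable_fun D (\1_(@ls_set _ _ _ _ s k) : R -> R).
  by apply: measurable_funTS; apply: measurable_indic; exact: ls_measurable.
by repeat apply: measurable_funB; apply: measurable_dot_sum.
Qed.

(* The coordinates c of the integral are left free: testing against e_l
   (L2dot_simple_int) forces c_l to be the integral of g_l. *)
Definition comb_simple (g : 'I_n -> R -> R) := exists (s : L2simple mu) c,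
  (forall t, L2simple_fun s t = comb (g^~ t)) /\ L2simple_int D s = comb c.

Lemma comb_simple0 : comb_simple (fun _ _ => 0).
Proof.
exists (@MkL2simple _ _ _ mu 0 (fun=> set0) (fun=> 0) (fun=> measurable0)).
exists (fun=> 0); split => [t|]; rewrite /L2simple_fun /L2simple_int /comb;
  by rewrite big_ord0 big1// => l _; rewrite scale0r.
Qed.

(** The two families of sets and values are concatenated over ['I_(N + N')]; the sets may overlap,
    since [L2simple] does not ask for a partition. *)
Lemma comb_simpleD g g' : comb_simple g -> comb_simple g' ->
  comb_simple (fun l t => g l t + g' l t).
Proof.
move=> [[N A v mA] [c [sg sc]]] [[N' A' v' mA'] [c' [sg' sc']]].
pose A'' (i : 'I_(N + N')) := match fintype.split i with inl j => A j | inr j => A' j end.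
pose v'' (i : 'I_(N + N')) := match fintype.split i with inl j => v j | inr j => v' j end.
have mA'' i : measurable (A'' i) by rewrite /A''; case: fintype.split.
exists (MkL2simple v'' mA''), (fun l => c l + c' l).
have combD (a b : 'I_n -> R) : comb (fun l => a l + b l) = comb a + comb b.
  by rewrite /comb -big_split; apply: eq_bigr => l _; rewrite scalerDl.
have Al i : A'' (lshift N' i) = A i by rewrite /A'' (unsplitK (inl _ i)).
have Ar i : A'' (rshift N i) = A' i by rewrite /A'' (unsplitK (inr _ i)).
have vl i : v'' (lshift N' i) = v i by rewrite /v'' (unsplitK (inl _ i)).
have vr i : v'' (rshift N i) = v' i by rewrite /v'' (unsplitK (inr _ i)).
split => [t|]; rewrite combD.
- rewrite -sg -sg' /L2simple_fun /= big_split_ord.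
  by congr (_ + _); apply: eq_bigr => i _; rewrite ?(Al, Ar, vl, vr).
- rewrite -sc -sc' /L2simple_int /= big_split_ord.
  by congr (_ + _); apply: eq_bigr => i _; rewrite ?(Al, Ar, vl, vr).
Qed.

Lemma comb_simple_sum (I : Type) (r : seq I) (g : I -> 'I_n -> R -> R) :
  (forall i, comb_simple (g i)) ->
  comb_simple (fun l t => \sum_(i <- r) g i l t).
Proof.
move=> gi; elim: r => [|i r IH].
  rewrite (_ : (fun _ _ => _) = (fun _ _ => 0)); first exact: comb_simple0.
  by apply/funext => l; apply/funext => t; rewrite big_nil.
rewrite (_ : (fun _ _ => _) = fun l t => g i l t + \sum_(j <- r) g j l t).
  exact: comb_simpleD.
by apply/funext => l; apply/funext => t; rewrite big_cons.
Qed.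

Lemma comb_simple_indic (A : set (measurableTypeR R)) l0 (y : R) : measurable A ->
  comb_simple (fun l t => (l == l0)%:R * (y * \1_A t)).
Proof.
move=> mA; exists (@MkL2simple _ _ _ mu 1 (fun=> A) (fun=> y *: e l0) (fun=> mA)).
have comb1 (a : R) : comb (fun l => (l == l0)%:R * (y * a)) = a *: (y *: e l0).
  rewrite /comb (bigD1 l0)//= eqxx mul1r big1 ?addr0 => [|l /negPf ->].
    by rewrite scalerA mulrC.
  by rewrite mul0r scale0r.
exists (fun l => (l == l0)%:R * (y * fine (lebesgue_measure (D `&` A)))).
by split => [t|]; rewrite comb1 /L2simple_fun /L2simple_int big_ord1.
Qed.

(** Each coordinate is the sum over its finite range of [y] times the indicator of the level set of
    [y]; each such piece is a one-term simple function with value [y *: e l0]. *)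
Lemma comb_simple_sfun (g : 'I_n -> {sfun (measurableTypeR R) >-> R}) :
  comb_simple (fun l t => g l t).
Proof.
rewrite (_ : (fun l t => g l t) = fun l t => \sum_(l0 <- index_enum 'I_n)
    \sum_(y <- fset_set (range (g l0))) (l == l0)%:R * (y * \1_(g l0 @^-1` [set y]) t)).
  apply: (@comb_simple_sum _ _ (fun l0 l t => \sum_(y <- fset_set (range (g l0)))
    (l == l0)%:R * (y * \1_(g l0 @^-1` [set y]) t))) => l0.
  apply: (@comb_simple_sum _ _ (fun y l t =>
    (l == l0)%:R * (y * \1_(g l0 @^-1` [set y]) t))) => y.
  apply: comb_simple_indic.
  rewrite -[X in measurable X]setTI; exact: measurable_funP.
apply/funext => l; apply/funext => t.
rewrite (bigD1 l)//= [X in _ + X]big1 => [|l0 l0l]; last first.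
  by apply: big1 => y _; rewrite eq_sym (negPf l0l) mul0r.
rewrite addr0 eqxx fimfunE fsbig_finite//=.
by apply: eq_bigr => y _; rewrite mul1r.
Qed.

End simple_functions_in_span.
End orthonormal_family.

(** * Real-valued integrals of finite linear combinations *)

Lemma integrable_sum_EFin (disp : measure_display) (T : measurableType disp)
    (R : realType) (mu : {measure set T -> \bar R}) (D : set T) (I : Type)
    (r : seq I) (F : I -> T -> R) : measurable D ->
  (forall i, mu.-integrable D (EFin \o F i)) ->
  mu.-integrable D (EFin \o (fun x => \sum_(i <- r) F i x)).
Proof.
move=> mD Fi; rewrite (_ : _ \o _ = (fun x => \sum_(i <- r) (EFin \o F i) x)%E).
  by apply: integrable_sum => // i _; exact: Fi.
by apply/funext => x; rewrite /= sumEFin.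
Qed.

Lemma Rintegral_sum (disp : measure_display) (T : measurableType disp)
    (R : realType) (mu : {measure set T -> \bar R}) (D : set T) (I : Type)
    (r : seq I) (F : I -> T -> R) : measurable D ->
  (forall i, mu.-integrable D (EFin \o F i)) ->
  \int[mu]_(x in D) (\sum_(i <- r) F i x) = \sum_(i <- r) \int[mu]_(x in D) F i x.
Proof.
move=> mD Fi; elim: r => [|i r IH].
  under eq_Rintegral do rewrite big_nil.
  by rewrite big_nil Rintegral_cst// mul0r.
under eq_Rintegral do rewrite big_cons.
rewrite big_cons RintegralD ?IH//; exact: integrable_sum_EFin.
Qed.

Lemma integrableZl_EFin (disp : measure_display) (T : measurableType disp)
    (R : realType) (mu : {measure set T -> \bar R}) (D : set T) (F : T -> R) (r : R) :
  measurable D -> mu.-integrable D (EFin \o F) ->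
  mu.-integrable D (EFin \o (fun x => r * F x)).
Proof. by move=> mD Fi; exact: (integrableZl mD r Fi). Qed.

Lemma integrableB_EFin (disp : measure_display) (T : measurableType disp)
    (R : realType) (mu : {measure set T -> \bar R}) (D : set T) (F G : T -> R) :
  measurable D -> mu.-integrable D (EFin \o F) -> mu.-integrable D (EFin \o G) ->
  mu.-integrable D (EFin \o (fun x => F x - G x)).
Proof. by move=> mD Fi Gi; exact: (integrableB mD Fi Gi). Qed.

(** * Existence and weak uniqueness of the Bochner integral in the span *)

Section bochner_span.
Context {disp : measure_display} {T : measurableType disp} {R : realType}.
Variable mu : {measure set T -> \bar R}.
Variables (n : nat) (e : 'I_n -> L2 mu).
Hypothesis e_orthonormal : forall k l, L2dot (e k) (e l) = (k == l)%:R.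
Variables (D : set (measurableTypeR R)) (mD : measurable D)
  (D_finite : (lebesgue_measure D < +oo)%E).

Local Notation leb := (@lebesgue_measure R).

Lemma integrable_indic_sub (A : set (measurableTypeR R)) : measurable A ->
  leb.-integrable D (EFin \o \1_A).
Proof.
move=> mA; apply/integrableP; split.
  by apply/measurable_EFinP; apply: measurable_funTS; exact: measurable_indic.
under eq_integral do rewrite gee0_abs ?lee_fin//.
rewrite integral_indic// (le_lt_trans _ D_finite)//.
apply: le_measure; rewrite ?mem_set//; exact: measurableI.
Qed.

Lemma integrable_dot_simple (s : L2simple mu) (f : L2 mu) :
  leb.-integrable D (EFin \o (fun t => L2dot (L2simple_fun s t) f)).
Proof.
rewrite (_ : (fun t => _) = fun t => \sum_k
    (L2dot (@ls_val _ _ _ _ s k) f * \1_(ls_set k) t)); last first.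
  by apply/funext => t; rewrite L2dot_simple_fun; apply: eq_bigr => k _; rewrite mulrC.
apply: integrable_sum_EFin => // k; apply: integrableZl_EFin => //.
by apply: integrable_indic_sub; exact: ls_measurable.
Qed.

(** On simple functions, testing against [f] commutes with integration, by linearity; finiteness of
    the measure of [D] makes the indicators integrable. *)
Lemma L2dot_simple_int (s : L2simple mu) (f : L2 mu) :
  L2dot (L2simple_int D s) f = \int[leb]_(t in D) L2dot (L2simple_fun s t) f.
Proof.
have iA k : leb.-integrable D (EFin \o \1_(@ls_set _ _ _ _ s k)).
  by apply: integrable_indic_sub; exact: ls_measurable.
under eq_Rintegral do rewrite L2dot_simple_fun.
rewrite Rintegral_sum//; last first.
  by move=> k; under eq_fun do rewrite mulrC; exact: integrableZl_EFin.
rewrite L2dot_suml; apply: eq_bigr => k _; rewrite L2dotZl RintegralZr//.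
by rewrite /Rintegral integral_indic// 1?setIC//; exact: ls_measurable.
Qed.

Variables (h : R -> L2 mu) (q : 'I_n -> R -> R).
Hypothesis q_int : forall l, leb.-integrable D (EFin \o q l).
Hypothesis hq : forall t, D t -> L2eq (h t) (comb e (q^~ t)).

Let mq l : measurable_fun D (q l).
Proof. by apply/measurable_EFinP; exact: measurable_int (q_int l). Qed.

Lemma L2norm_simple_sub (s : L2simple mu) t : D t ->
  L2norm (L2simple_fun s t - h t) = L2norm (L2simple_fun s t - comb e (q^~ t)).
Proof. by move=> Dt; apply/L2norm_eq/L2eqB/hq => //; exact: L2eq_refl. Qed.

(* Bochner integrals are unique only up to a.e. equality, and h itself need not
   be measurable; both are circumvented by testing against a fixed f, since
   h agrees with the measurable combination of the e_l. *)
Lemma is_bochner_dot I f : is_bochner D h I ->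
  L2dot I f = L2dot (comb_int e D q) f.
Proof.
move=> [s [_ sh sI]].
have qi : leb.-integrable D (EFin \o (fun t => L2dot (comb e (q^~ t)) f)).
  under [X in EFin \o X]eq_fun do rewrite L2dot_comb.
  apply: integrable_sum_EFin => // l; under eq_fun do rewrite mulrC.
  exact: integrableZl_EFin.
have -> : L2dot (comb_int e D q) f = \int[leb]_(t in D) L2dot (comb e (q^~ t)) f.
  under eq_Rintegral do rewrite L2dot_comb.
  rewrite Rintegral_sum//; last first.
    by move=> l; under eq_fun do rewrite mulrC; exact: integrableZl_EFin.
  by rewrite L2dot_comb; apply: eq_bigr => l _; rewrite RintegralZr.
have := @L2cvg_dot _ _ _ _ _ _ f sI; under eq_fun do rewrite L2dot_simple_int.
move=> sIf; apply: (cvg_unique _ sIf) => //.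
apply/subr_cvg0/norm_cvg0P.
(* The error at stage [k] is the absolute value of the integral of [d k]. By Cauchy-Schwarz it is at
   most [N k * L2norm f], and [N k] tends to 0 by [sh]. *)
pose d k t := L2dot (L2simple_fun (s k) t - comb e (q^~ t)) f.
have di k : leb.-integrable D (EFin \o d k).
  rewrite /d; under [X in EFin \o X]eq_fun do rewrite L2dotBl.
  by apply: integrableB_EFin => //; exact: integrable_dot_simple.
pose N k := (\int[leb]_(t in D) (L2norm (L2simple_fun (s k) t - h t))%:E)%E.
apply: (@fine_cvg _ _ _ _ (EFin \o _)).
apply: (@squeeze_cvge _ _ _ _ (cst 0%E) _ (fun k => N k * (L2norm f)%:E)%E).
- near=> k; rewrite lee_fin normr_ge0/=.
  have -> : \int[leb]_(t in D) L2dot (L2simple_fun (s k) t) f -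
      \int[leb]_(t in D) L2dot (comb e (q^~ t)) f = \int[leb]_(t in D) d k t.
    rewrite -RintegralB//; last exact: integrable_dot_simple.
    by apply: eq_Rintegral => t _; rewrite /d L2dotBl.
  rewrite [leLHS](_ : _ = `|\int[leb]_(t in D) d k t|%:E)//.
  rewrite EFin_normr_Rintegral//.
  apply: (le_trans (le_abse_integral _ mD (measurable_int _ (di k)))).
  have mn := measurable_norm_simple_sub e (s k) mq.
  have -> : N k = (\int[leb]_(t in D)
      (L2norm (L2simple_fun (s k) t - comb e (q^~ t)))%:E)%E.
    by apply: eq_integral => t /set_mem Dt; rewrite L2norm_simple_sub.
  rewrite -ge0_integralZr//; last 3 first.
  + exact/measurable_EFinP.
  + by move=> t _; rewrite lee_fin L2norm_ge0.
  + by rewrite lee_fin L2norm_ge0.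
  apply: ge0_le_integral => //.
  + by apply: measurableT_comp => //; exact: measurable_int (di k).
  + by apply/measurable_EFinP; apply: measurable_funM.
  + by move=> t Dt; rewrite lee_fin L2dot_le_norm.
- exact: cvg_cst.
- rewrite [X in _ --> X](_ : _ = 0 * (L2norm f)%:E)%E; last by rewrite mul0e.
  exact: cvgeZr.
Unshelve. all: by end_near. Qed.

(** Each integrable coordinate is approximated pointwise and in mean by real simple functions;
    [comb_simple_sfun] assembles these into simple functions with values in the span. *)
Lemma is_bochner_comb_int : is_bochner D h (comb_int e D q).
Proof.
have [g gP] := choice (fun l => approximation_sfun_integrable mD (q_int l)).
have gi l k : leb.-integrable D (EFin \o g l k) by have [] := gP l.
have gq l t : D t -> g l k t @[k --> \oo] --> q l t.
  by have [_ + _] := gP l => /[apply] /fine_cvg.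
have gI l : (\int[leb]_(t in D) `|(q l t - g l k t)%:E|)%E @[k --> \oo] --> 0%E.
  by have [_ _] := gP l.
have [s sP] := choice (fun k => comb_simple_sfun e D (fun l => g l k)).
have sg k t : L2simple_fun (s k) t = comb e (fun l => g l k t).
  by have [c []] := sP k.
(* Testing against [e l] identifies the free coordinates left by [comb_simple]. *)
have si k : L2simple_int D (s k) = comb_int e D (fun l => g l k).
  have [c [_ sc]] := sP k; rewrite sc; congr comb; apply/funext => l.
  rewrite -(L2dot_comb_coord e_orthonormal c l) -sc L2dot_simple_int.
  by apply: eq_Rintegral => t _; rewrite sg L2dot_comb_coord.
have mg l k : measurable_fun D (fun t => q l t - g l k t).
  apply: measurable_funB => //.
  by apply/measurable_EFinP; exact: measurable_int (gi l k).
exists s; split.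
- apply: aeW => t Dt; apply: (L2cvg_comb e_orthonormal) (hq Dt) _ => [k|l].
    by rewrite sg; exact: L2eq_refl.
  exact: gq.
(* Convergence in mean: the norm of the error is at most the sum of the coordinate errors, each of
   which tends to 0 in mean by [gI]. *)
- apply: (@squeeze_cvge _ _ _ _ (cst 0%E) _
    (fun k => \sum_l \int[leb]_(t in D) `|(q l t - g l k t)%:E|)%E).
  + near=> k; apply/andP; split.
      by apply: integral_ge0 => t _; rewrite lee_fin L2norm_ge0.
    rewrite -ge0_integral_sum//; last first.
      by move=> l; apply: measurableT_comp => //; exact/measurable_EFinP.
    have -> : (\int[leb]_(t in D) (L2norm (L2simple_fun (s k) t - h t))%:E =
        \int[leb]_(t in D) (L2norm (L2simple_fun (s k) t - comb e (q^~ t)))%:E)%E.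
      by apply: eq_integral => t /set_mem Dt; rewrite L2norm_simple_sub.
    apply: ge0_le_integral => //.
    * by move=> t _; rewrite lee_fin L2norm_ge0.
    * by apply/measurable_EFinP; exact: measurable_norm_simple_sub.
    * apply: emeasurable_sum => l.
      by apply: measurableT_comp => //; exact/measurable_EFinP.
    * move=> t Dt; rewrite sumEFin lee_fin sg combB.
      rewrite (le_trans (L2norm_comb_le e_orthonormal _))//.
      by apply: ler_sum => l _; rewrite distrC.
  + exact: cvg_cst.
  + rewrite [X in _ --> X](_ : _ = \sum_(l < n) 0)%E; last by rewrite big1.
    by apply: cvg_nnesum => // l _; near=> k; exact: integral_ge0.
- apply: (L2cvg_comb e_orthonormal) => [k||l].
  + by rewrite si; exact: L2eq_refl.
  + exact: L2eq_refl.
  + apply/subr_cvg0/norm_cvg0P.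
    apply: (@fine_cvg _ _ _ _ (EFin \o _)).
    apply: (@squeeze_cvge _ _ _ _ (cst 0%E) _
      (fun k => \int[leb]_(t in D) `|(q l t - g l k t)%:E|)%E) => //.
      near=> k; apply/andP; split; first by rewrite lee_fin normr_ge0.
      rewrite [leLHS](_ : _ = `|\int[leb]_(t in D) (q l t - g l k t)|%:E); last first.
        by rewrite RintegralB//; exact: (congr1 EFin (distrC _ _)).
      rewrite EFin_normr_Rintegral//.
        by apply: le_abse_integral => //; exact/measurable_EFinP.
      exact: integrableB_EFin.
    exact: cvg_cst.
Unshelve. all: by end_near. Qed.

(** A Bochner integral exists, so [xget] returns one, and all of them have the same inner
    products. *)
Lemma L2dot_bochner f : L2dot (bochner D h) f =
  \sum_l (\int[leb]_(t in D) q l t) * L2dot (e l) f.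
Proof.
rewrite (is_bochner_dot f (xgetPex 0 (ex_intro _ _ is_bochner_comb_int))).
by rewrite L2dot_comb.
Qed.

End bochner_span.

(** * Galerkin operators in coordinates *)

Section bounded_multiplier.
Context {disp : measure_display} {T : measurableType disp} {R : realType}.
Variable mu : {measure set T -> \bar R}.

Lemma Linf_bounded (a : Linf mu) : exists M : R, {ae mu, forall x, `|a x| <= M}.
Proof.
have := @Lfunction_finite _ _ _ mu _ _ a; rewrite /finite_norm unlock.
case: ifPn => [_ /ess_supr_bounded//|].
(* If the whole space has measure 0, every property holds almost everywhere, with [setT] as
   exceptional set, so any bound will do. *)
rewrite -leNgt measure_le0 => /eqP mu0 _; exists 0, setT.
by split.
Qed.

(** With [M] an essential bound of [a], the square of [a * f] is almost everywhere at most
    [M ^+ 2 * f ^+ 2], which is integrable. *)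
Lemma Linf_mul_Lfun2 (a : Linf mu) (f : L2 mu) :
  (fun x => a x * f x) \in Lfun mu 2%:E.
Proof.
have maf : measurable_fun setT (fun x => a x * f x).
  by apply: measurable_funM; exact: measurable_funP.
apply/andP; split; apply: mem_set => //=.
have [M aM] := Linf_bounded a.
rewrite /finite_norm unlock; apply: poweR_lty => /=.
apply: (@le_lt_trans _ _ (\int[mu]_x (M ^+ 2 * f x ^+ 2)%:E)%E).
  apply: ae_ge0_le_integral => //.
  - apply/measurable_EFinP; apply: (measurableT_comp (measurable_powR _)) => //.
    exact: measurableT_comp.
  - by move=> x _; rewrite lee_fin mulr_ge0 ?sqr_ge0.
  - apply/measurable_EFinP; apply: measurable_funM => //.
    by apply: measurable_funX; exact: measurable_funP.
  - apply: filterS aM => x aM _; rewrite lee_fin powR_mulrn//.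
    rewrite real_normK ?num_real// exprMn ler_wpM2r ?sqr_ge0//.
    by rewrite -(real_normK (num_real (a x))) ler_sqr ?nnegrE// (le_trans _ aM).
have fi := Lfun2_integrable_sqr (LfunP f).
have : mu.-integrable setT (EFin \o (fun x => M ^+ 2 * f x ^+ 2)).
  exact: (integrableZl measurableT (M ^+ 2) fi).
move=> /integrableP[_]; apply: le_lt_trans; apply: ge0_le_integral => //.
- by move=> x _; rewrite lee_fin mulr_ge0 ?sqr_ge0.
- apply/measurable_EFinP; apply: measurable_funM => //.
  by apply: measurable_funX; exact: measurable_funP.
- apply: measurableT_comp => //.
  apply/measurable_EFinP; apply: measurable_funM => //.
  by apply: measurable_funX; exact: measurable_funP.
- by move=> x _ /=; rewrite lee_fin ler_norm.
Qed.

Definition LinfM (a : Linf mu) (f : L2 mu) : L2 mu :=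
  Lfun_Sub (lee1n 2) (Linf_mul_Lfun2 a f).

Lemma LinfME a f x : LinfM a f x = a x * f x. Proof. by []. Qed.

Lemma LinfMD a f g : LinfM a (f + g) = LinfM a f + LinfM a g.
Proof. by apply/LfuneqP => x; rewrite L2DE !LinfME L2DE mulrDr. Qed.

Lemma LinfMZ a r f : LinfM a (r *: f) = r *: LinfM a f.
Proof. by apply/LfuneqP => x; rewrite L2ZE !LinfME L2ZE mulrCA. Qed.

Lemma LinfM_eq a f g : L2eq f g -> L2eq (LinfM a f) (LinfM a g).
Proof. by apply: filterS => x fg; rewrite !LinfME fg. Qed.

End bounded_multiplier.

(** * Bilinearity of [Bform] and its compatibility with a.e. equality *)

Section bilinear_form.
Context {R : realType} {d : nat} {Omega : set 'rV[R]_d} (oO : open Omega).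
Variables (a : 'I_d -> 'I_d -> Linf (lebesgue_on oO))
  (b : 'I_d -> Linf (lebesgue_on oO)) (c : Linf (lebesgue_on oO)).
Implicit Types U V : H1pair d oO.

(** Absorbing each coefficient into an [L2] factor by [LinfM] makes every term integrable, so the
    integral splits. The lemmas below then reduce to those on [L2dot]. *)
Lemma BformE U V : Bform a b c U V =
  \sum_i \sum_j L2dot (LinfM (a i j) (U.2 i)) (V.2 j) +
  \sum_i L2dot (LinfM (b i) (U.2 i)) V.1 + L2dot (LinfM c U.1) V.1.
Proof.
have Ii (q : Linf (lebesgue_on oO)) (f g : L2 (lebesgue_on oO)) :
    (lebesgue_on oO).-integrable setT (EFin \o (fun x => q x * f x * g x)).
  exact: L2_integrableM (LinfM q f) g.
have I1 i : (lebesgue_on oO).-integrable setT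
    (EFin \o (fun x => \sum_j a i j x * U.2 i x * V.2 j x)).
  by apply: integrable_sum_EFin.
have I2 : (lebesgue_on oO).-integrable setT
    (EFin \o (fun x => \sum_i \sum_j a i j x * U.2 i x * V.2 j x)).
  by apply: integrable_sum_EFin.
have I3 : (lebesgue_on oO).-integrable setT
    (EFin \o (fun x => \sum_i b i x * U.2 i x * V.1 x)).
  by apply: integrable_sum_EFin.
rewrite /Bform RintegralD//; last exact: (integrableD measurableT I2 I3).
rewrite RintegralD// !Rintegral_sum//; congr (_ + _ + _).
by apply: eq_bigr => i _; rewrite Rintegral_sum.
Qed.

Lemma BformDl U U' V : Bform a b c (U + U') V = Bform a b c U V + Bform a b c U' V.
Proof.
rewrite !BformE LinfMD L2dotDl.
under eq_bigr do under eq_bigr do rewrite LinfMD L2dotDl.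
under eq_bigr do rewrite big_split.
under [X in _ + X + _]eq_bigr do rewrite LinfMD L2dotDl.
by rewrite !big_split/=; ring.
Qed.

Lemma BformZl r U V : Bform a b c (r *: U) V = r * Bform a b c U V.
Proof.
rewrite !BformE LinfMZ L2dotZl.
under eq_bigr do under eq_bigr do rewrite LinfMZ L2dotZl.
under eq_bigr do rewrite -mulr_sumr.
under [X in _ + X + _]eq_bigr do rewrite LinfMZ L2dotZl.
by rewrite -!mulr_sumr; ring.
Qed.

Lemma BformDr U V V' : Bform a b c U (V + V') = Bform a b c U V + Bform a b c U V'.
Proof.
rewrite !BformE L2dotDr.
under eq_bigr do under eq_bigr do rewrite L2dotDr.
under eq_bigr do rewrite big_split.
under [X in _ + X + _]eq_bigr do rewrite L2dotDr.
by rewrite !big_split/=; ring.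
Qed.

Lemma BformZr r U V : Bform a b c U (r *: V) = r * Bform a b c U V.
Proof.
rewrite !BformE L2dotZr.
under eq_bigr do under eq_bigr do rewrite L2dotZr.
under eq_bigr do rewrite -mulr_sumr.
under [X in _ + X + _]eq_bigr do rewrite L2dotZr.
by rewrite -!mulr_sumr; ring.
Qed.

Lemma Bform_suml (n : nat) (k : 'I_n -> R) (U : 'I_n -> H1pair d oO) V :
  Bform a b c (\sum_l k l *: U l) V = \sum_l k l * Bform a b c (U l) V.
Proof.
elim/big_ind2: _ => [|x U1 y U2 <- <-|l _]; last exact: BformZl.
- by rewrite -(scale0r 0) BformZl mul0r.
- exact: BformDl.
Qed.

Lemma Bform_sumr (n : nat) (k : 'I_n -> R) (V : 'I_n -> H1pair d oO) U :
  Bform a b c U (\sum_l k l *: V l) = \sum_l k l * Bform a b c U (V l).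
Proof.
elim/big_ind2: _ => [|x U1 y U2 <- <-|l _]; last exact: BformZr.
- by rewrite -(scale0r 0) BformZr mul0r.
- exact: BformDr.
Qed.

Lemma Bform_eq U U' V V' : H1eq U U' -> H1eq V V' ->
  Bform a b c U V = Bform a b c U' V'.
Proof.
move=> [U1 U2] [V1 V2]; rewrite !BformE; congr (_ + _ + _).
- apply: eq_bigr => i _; apply: eq_bigr => j _.
  by rewrite (L2dot_eqr _ (V2 j)); apply/L2dot_eql/LinfM_eq.
- by apply: eq_bigr => i _; rewrite (L2dot_eqr _ V1); apply/L2dot_eql/LinfM_eq.
- by rewrite (L2dot_eqr _ V1); apply/L2dot_eql/LinfM_eq.
Qed.

End bilinear_form.

(** * Coordinates of the discrete generator, semigroup and projection *)

Section galerkin.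
Context {R : realType} {d : nat} {Omega : set 'rV[R]_d} (oO : open Omega).
Variables (a : 'I_d -> 'I_d -> Linf (lebesgue_on oO))
  (b : 'I_d -> Linf (lebesgue_on oO)) (c : Linf (lebesgue_on oO)).
Variables (n : nat) (phi : 'I_n -> H1pair d oO).
Hypothesis phi_orthonormal : L2orthonormal phi.

Local Notation XK := (spanned_by phi).
Local Notation e := (fun l => (phi l).1).
Implicit Types (U V W : H1pair d oO) (v : 'cV[R]_n).

Definition H1comb v : H1pair d oO := \sum_l v l ord0 *: phi l.

(** Only the function component is read; on the span it also determines the weak gradient up to a.e.
    equality, by [spannedP]. *)
Definition H1coord U : 'cV[R]_n := \col_k L2dot U.1 (phi k).1.

Lemma H1eq_refl U : H1eq U U.
Proof. by split=> [|i]; exact: L2eq_refl. Qed.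

Lemma H1eqD U U' V V' : H1eq U U' -> H1eq V V' -> H1eq (U + V) (U' + V').
Proof. by move=> [U1 U2] [V1 V2]; split=> [|i]; exact: L2eqD. Qed.

Lemma H1eqZ (r : R) U V : H1eq U V -> H1eq (r *: U) (r *: V).
Proof. by move=> [U1 U2]; split=> [|i]; exact: L2eqZ. Qed.

Lemma fst_lincomb (k : 'I_n -> R) : (\sum_l k l *: phi l).1 = comb e k.
Proof. by rewrite /comb; elim/big_rec2: _ => // l y z _ <-. Qed.

Lemma H1comb1 v : (H1comb v).1 = comb e (fun l => v l ord0).
Proof. exact: fst_lincomb. Qed.

Lemma H1coordD U V : H1coord (U + V) = H1coord U + H1coord V.
Proof. by apply/colP => k; rewrite !mxE -L2dotDl. Qed.

Lemma H1coordZ (r : R) U : H1coord (r *: U) = r *: H1coord U.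
Proof. by apply/colP => k; rewrite !mxE -L2dotZl. Qed.

Lemma H1coord_H1comb v : H1coord (H1comb v) = v.
Proof. by apply/colP => k; rewrite mxE H1comb1 (L2dot_comb_coord phi_orthonormal). Qed.

Lemma H1combD v w : H1comb (v + w) = H1comb v + H1comb w.
Proof. by rewrite /H1comb -big_split; apply: eq_bigr => l _; rewrite mxE scalerDl. Qed.

Lemma H1combZ (r : R) v : H1comb (r *: v) = r *: H1comb v.
Proof. by rewrite /H1comb scaler_sumr; apply: eq_bigr => l _; rewrite mxE scalerA. Qed.

Lemma H1comb0 : H1comb 0 = 0.
Proof. by rewrite -(scale0r 0) H1combZ scale0r. Qed.

Lemma spannedP U : XK U <-> H1eq U (H1comb (H1coord U)).
Proof.
split=> [[k Uk]|Uc]; last by exists (fun l => H1coord U l ord0).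
suff -> : H1comb (H1coord U) = \sum_l k l *: phi l by [].
apply: eq_bigr => l _; congr (_ *: _); rewrite mxE.
rewrite (L2dot_eql _ Uk.1).
by rewrite fst_lincomb (L2dot_comb_coord phi_orthonormal).
Qed.

Lemma spanned_comb v : XK (H1comb v).
Proof. by apply/spannedP; rewrite H1coord_H1comb; exact: H1eq_refl. Qed.

Lemma spanned_basis k : XK (phi k).
Proof.
suff -> : phi k = H1comb (delta_mx k ord0) by exact: spanned_comb.
rewrite /H1comb (bigD1 k)//= mxE !eqxx scale1r big1 ?addr0// => l lk.
by rewrite mxE (negPf lk) scale0r.
Qed.

Lemma spanned_lincomb (I : Type) (s : seq I) (r : I -> R) (U : I -> H1pair d oO) :
  (forall i, XK (U i)) -> XK (\sum_(i <- s) r i *: U i).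
Proof.
move=> XU; elim/big_ind: _ => [|V W /spannedP VV /spannedP WW|i _].
- by rewrite -H1comb0; exact: spanned_comb.
- by apply/spannedP; rewrite H1coordD H1combD; exact: H1eqD.
- by apply/spannedP; rewrite H1coordZ H1combZ; apply/H1eqZ/spannedP.
Qed.

Lemma H1coord_lincomb (I : Type) (s : seq I) (r : I -> R) (U : I -> H1pair d oO) :
  H1coord (\sum_(i <- s) r i *: U i) = \sum_(i <- s) r i *: H1coord (U i).
Proof.
elim: s => [|i s IH]; last by rewrite !big_cons H1coordD H1coordZ IH.
by rewrite !big_nil -(scale0r 0) H1coordZ scale0r.
Qed.

Lemma L2eq_comb_coord U : XK U -> L2eq U.1 (comb e (fun l => H1coord U l ord0)).
Proof. by move=> /spannedP [U1 _]; rewrite -H1comb1. Qed.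

(** The combination with the stated coordinates meets the defining condition, so [xget] returns some
    valid element; testing that element against the basis recovers its coordinates. [SK_spec] and
    [PK_spec] follow the same pattern. *)
Lemma opAK_spec U : XK U -> XK (opAK a b c XK U) /\
  H1coord (opAK a b c XK U) = mxAK a b c phi *m H1coord U.
Proof.
move=> XU; have BU V : Bform a b c U V = Bform a b c (H1comb (H1coord U)) V.
  by apply: Bform_eq; [exact/spannedP|exact: H1eq_refl].
have AU k : (mxAK a b c phi *m H1coord U) k ord0 = - Bform a b c U (phi k).
  rewrite BU Bform_suml mxE -sumrN; apply: eq_bigr => l _.
  by rewrite !mxE mulNr mulrC.
have [] : [set W | XK W /\ forall V, XK V -> L2dot W.1 V.1 = - Bform a b c U V]
    (opAK a b c XK U).
  rewrite /opAK; apply: xgetPex.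
  exists (H1comb (mxAK a b c phi *m H1coord U)); split; first exact: spanned_comb.
  move=> V /spannedP VV.
  rewrite (Bform_eq a b c (H1eq_refl U) VV) Bform_sumr H1comb1 L2dot_comb.
  rewrite -sumrN; apply: eq_bigr => k _.
  by rewrite AU [H1coord V _ _]mxE (L2dotC V.1) mulNr mulrC.
move=> XW WV; split=> //; apply/colP => k; rewrite AU mxE.
exact/WV/spanned_basis.
Qed.

Lemma iter_opAK_spec U l : XK U -> XK (iter l (opAK a b c XK) U) /\
  H1coord (iter l (opAK a b c XK) U) = mxAK a b c phi ^+ l *m H1coord U.
Proof.
move=> XU; elim: l => [|l [XI cI]]; first by rewrite expr0 mul1mx.
rewrite iterS; have [XA ->] := opAK_spec XI; split=> //.
by rewrite cI exprS mulmxA.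
Qed.

Lemma SK_spec t U : XK U -> XK (SK a b c XK t U) /\
  H1coord (SK a b c XK t U) = mexp (t *: mxAK a b c phi) *m H1coord U.
Proof.
move=> XU; set s := fun N => (\sum_(l < N) (t ^+ l / l`!%:R) *:
  iter l (opAK a b c XK) U).1.
have sE N : H1coord (\sum_(l < N) (t ^+ l / l`!%:R) *: iter l (opAK a b c XK) U) =
    mexp_partial (t *: mxAK a b c phi) N *m H1coord U.
  rewrite H1coord_lincomb mexp_partialZ mulmx_suml; apply: eq_bigr => l _.
  by rewrite (iter_opAK_spec l XU).2 scalemxAl.
have scvg k : (mexp_partial (t *: mxAK a b c phi) N *m H1coord U) k ord0
    @[N --> \oo] --> (mexp (t *: mxAK a b c phi) *m H1coord U) k ord0.
  rewrite mxE; under eq_fun do rewrite mxE.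
  apply: cvg_big => [|l _]; first exact: add_continuous.
  by apply: cvgMl; exact: cvg_mexp.
have [] : [set W | XK W /\ L2cvg s W.1] (SK a b c XK t U).
  rewrite /SK; apply: xgetPex.
  exists (H1comb (mexp (t *: mxAK a b c phi) *m H1coord U)).
  split; first exact: spanned_comb.
  apply: (L2cvg_comb phi_orthonormal) scvg => [N|].
  - rewrite -sE; apply: L2eq_comb_coord; apply: spanned_lincomb => l.
    exact: (iter_opAK_spec l XU).1.
  - by rewrite H1comb1; exact: L2eq_refl.
move=> XW sW; split=> //; apply/colP => k; rewrite [LHS]mxE.
(* The [k]-th coordinate of the chosen limit is the limit of the [k]-th coordinates of the partial
   sums, already computed in [scvg]. *)
apply: (cvg_unique _ (L2cvg_dot (h := (phi k).1) sW)) => //.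
rewrite [X in X @ _](_ : _ = fun N =>
  (mexp_partial (t *: mxAK a b c phi) N *m H1coord U) k ord0); first exact: scvg.
by apply/funext => N; rewrite -sE mxE.
Qed.

Lemma PK_spec f : XK (PK XK f) /\ forall k, H1coord (PK XK f) k ord0 = L2dot f (phi k).1.
Proof.
have [] : [set W | XK W /\ forall V, XK V -> L2dot (f - W.1) V.1 = 0] (PK XK f).
  rewrite /PK; apply: xgetPex.
  exists (H1comb (\col_k L2dot f (phi k).1)); split; first exact: spanned_comb.
  move=> V XV; rewrite (L2dot_eqr _ (L2eq_comb_coord XV)) L2dotC L2dot_comb.
  apply: big1 => k _; rewrite L2dotC L2dotBl H1comb1.
  by rewrite (L2dot_comb_coord phi_orthonormal) mxE subrr mulr0.
move=> XW fW; split=> // k; rewrite mxE; apply/esym/eqP; rewrite -subr_eq0 -L2dotBl.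
exact/eqP/fW/spanned_basis.
Qed.

End galerkin.

(** * The discrete control map *)

Section discrete_control_map.
Context {R : realType} {d : nat} {Omega : set 'rV[R]_d} (oO : open Omega).
Variables (tF : R) (tF_gt0 : 0 < tF) (m : nat).
Variables (a : 'I_d -> 'I_d -> Linf (lebesgue_on oO))
  (b : 'I_d -> Linf (lebesgue_on oO)) (c : Linf (lebesgue_on oO)).
Variable beta : 'I_m -> L2 (lebesgue_on oO).
Variables (n : nat) (phi : 'I_n -> H1pair d oO).
Hypothesis phi_orthonormal : L2orthonormal phi.

Local Notation XK := (spanned_by phi).
Local Notation F := (mxF tF a b c phi beta).
Local Notation D := (`]0, tF[%classic : set (measurableTypeR R)).
Local Notation leb := (@lebesgue_measure R).
Local Notation T := (TK (tF := tF) a b c XK beta).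

Lemma mxFE tau i k : F tau i k =
  \sum_l mxMbeta phi beta l i * mexp ((tF - tau) *: mxAK a b c phi) k l.
Proof.
rewrite mxE; apply: eq_bigr => l _.
by rewrite mxE -linearZ -tr_mexp [_^T _ _]mxE.
Qed.

Lemma measurable_mxF i k : measurable_fun setT (fun tau => F tau i k).
Proof.
under eq_fun do rewrite mxFE.
apply: measurable_sum => l; apply: measurable_funM => //.
by apply: measurable_mexp; exact: measurable_funB.
Qed.

(** The bound is uniform in [tau] because [0 <= tF - tau <= tF] on the interval. *)
Lemma normr_mxF_le i k tau : D tau -> `|F tau i k| <=
  \sum_l `|mxMbeta phi beta l i| * expR (tF * mx_abs_sum (mxAK a b c phi)).
Proof.
rewrite /= in_itv/= => /andP[t0 tT]; rewrite mxFE.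
rewrite (le_trans (ler_norm_sum _ _ _))//; apply: ler_sum => l _.
rewrite normrM ler_wpM2l// (le_trans (normr_mexp_le _ _ _))//.
rewrite ler_expR mx_abs_sumZ ler_wpM2r ?mx_abs_sum_ge0//.
have tFt : 0 <= tF - tau by rewrite subr_ge0 ltW.
by rewrite ger0_norm// gerBl ltW.
Qed.

Lemma D_finite : (leb D < +oo)%E.
Proof. by rewrite lebesgue_measure_itv/= lte_fin tF_gt0 -EFinD ltry. Qed.

Lemma mxF_Lfun2 i k : (fun tau => F tau i k) \in Lfun (lebesgue_time tF) 2%:E.
Proof.
apply: bounded_Lfun2_mrestr (@normr_mxF_le i k); first exact: D_finite.
exact: measurable_mxF.
Qed.

Definition mxF_L2 i k : L2 (lebesgue_time tF) := Lfun_Sub (lee1n 2) (mxF_Lfun2 i k).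

Local Notation SF := (synthesis mxF_L2).
Local Notation AF := (analysis mxF_L2).
Implicit Types (u : 'I_m -> L2 (lebesgue_time tF)) (theta : L2 (lebesgue_on oO)).

(** Turns inner products in time into Lebesgue integrals over the open interval used by the Bochner
    integral in [TK]. *)
Lemma L2dot_time (f g : L2 (lebesgue_time tF)) :
  leb.-integrable D (EFin \o (fun t => f t * g t)) /\
  L2dot f g = \int[leb]_(t in D) (f t * g t).
Proof.
have fg := L2_integrableM f g; split; last exact: Rintegral_mrestr.
apply/(integrable_mrestr leb (measurable_itv `]0, tF[)) => //.
by apply/measurable_EFinP; apply: measurable_funM; exact: measurable_L2.
Qed.

Lemma mxG_gram : mxG tF a b c phi beta = gram mxF_L2.
Proof.
apply/matrixP => k l; rewrite !mxE.
under eq_Rintegral do rewrite mxE.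
under [RHS]eq_bigr do rewrite (L2dot_time _ _).2.
rewrite -Rintegral_sum//; last by move=> i; exact: (L2dot_time _ _).1.
(* [mxG] integrates over the closed interval and [gram] over the open one; the endpoints are
   negligible. *)
rewrite /Rintegral integral_itv_bndoo.
  congr fine; apply: eq_integral => t _; congr EFin.
  by apply: eq_bigr => i _; rewrite mxE.
apply/measurable_EFinP; apply: measurable_funTS; apply: measurable_sum => i.
under eq_fun do rewrite mxE.
by apply: measurable_funM; exact: measurable_mxF.
Qed.

(** The weak form of [T u = sum_k (AF u)_k phi_k]. *)
Lemma L2dot_TK u theta : L2dot (T u) theta =
  \sum_k vec_theta phi theta k ord0 * AF u k ord0.
Proof.
(* The vector [F(t)^T u(t)], which is [exp((tF - t) A_K) M_beta u(t)]: the coordinates of the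
   integrand at time [t]. *)
pose q k t := \sum_i F t i k * u i t.
have qi k i : leb.-integrable D (EFin \o (fun t => F t i k * u i t)).
  exact: (L2dot_time (mxF_L2 i k) (u i)).1.
rewrite /TK (@L2dot_bochner _ _ _ _ _ _ phi_orthonormal D _ D_finite _ q).
- apply: eq_bigr => k _; rewrite mulrC !mxE; congr (_ * _).
  by rewrite Rintegral_sum//; apply: eq_bigr => i _; rewrite (L2dot_time _ _).2.
- exact: measurable_itv.
- by move=> k; exact: integrable_sum_EFin.
- move=> t _; set f := \sum_i _; have [XP cP] := PK_spec phi_orthonormal f.
  have [XS cS] := SK_spec a b c phi_orthonormal (tF - t) XP.
  apply: L2eq_trans (L2eq_comb_coord phi_orthonormal XS) _.
  suff -> : (fun k => H1coord phi (SK a b c XK (tF - t) (PK XK f)) k ord0) = q^~ t.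
    exact: L2eq_refl.
  apply/funext => k; rewrite cS mxE /q.
  under eq_bigr do rewrite cP L2dot_suml mulr_sumr.
  rewrite exchange_big; apply: eq_bigr => i _; rewrite mxFE mulr_suml.
  by apply: eq_bigr => l _; rewrite L2dotZl [mxMbeta _ _ _ _]mxE; ring.
Qed.

Lemma vec_theta_TK u theta :
  vec_theta phi (T u - theta) = AF u - vec_theta phi theta.
Proof.
apply/colP => k; rewrite [LHS]mxE L2dotBr.
rewrite [RHS]mxE [X in _ = _ + X]mxE [X in _ = _ - X]mxE; congr (_ - _).
rewrite L2dotC L2dot_TK (bigD1 k)//= mxE phi_orthonormal eqxx mul1r big1 ?addr0// => l lk.
by rewrite mxE phi_orthonormal (negPf lk) mul0r.
Qed.

(** By [dot_synthesis] and [L2dot_TK] the right-hand side satisfies the adjoint identity, so [xget]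
    returns a function satisfying it too. *)
Lemma adjoint_TK theta i : L2eq (adjoint T theta i) (SF (vec_theta phi theta) i).
Proof.
have aP : [set w | forall u, L2dot (T u) theta = \sum_i L2dot (u i) (w i)]
    (adjoint T theta).
  rewrite /adjoint; apply: xgetPex.
  by exists (SF (vec_theta phi theta)) => u; rewrite dot_synthesis L2dot_TK.
(* Testing with a control concentrated in component [i] isolates the [i]-th component of the
   adjoint. *)
apply/L2eqP => f; pose u j := if j == i then f else 0.
have dotu (w : 'I_m -> L2 (lebesgue_time tF)) : \sum_j L2dot (u j) (w j) = L2dot (w i) f.
  rewrite (bigD1 i)//= /u eqxx big1 ?addr0 => [|j /negPf ->]; first exact: L2dotC.
  exact: L2dot0l.
by rewrite -!dotu -aP dot_synthesis L2dot_TK.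
Qed.

End discrete_control_map.

Theorem proposition4p2 (R : realType) (d : nat) (d_gt0 : (0 < d)%N)
  (Omega : set 'rV[R]_d) (oO : open Omega)
  (bO : bounded_set Omega) (cO : connected Omega)
  (tF : R) (tF_gt0 : 0 < tF) (m : nat) (m_gt0 : (0 < m)%N)
  (a : 'I_d -> 'I_d -> Linf (lebesgue_on oO))
  (b : 'I_d -> Linf (lebesgue_on oO)) (c : Linf (lebesgue_on oO))
  (a_sym : forall i j, {ae (lebesgue_on oO), forall x, a i j x = a j i x})
  (kappa kappa0 : R) (kappa_ge0 : 0 <= kappa) (kappa0_gt0 : 0 < kappa0)
  (B_Garding : Garding a b c kappa kappa0)
  (SA : R -> L2 (lebesgue_on oO) -> L2 (lebesgue_on oO))
  (SA_gen : generates SA (opA a b c))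
  (beta : 'I_m -> L2 (lebesgue_on oO)) (fS : L2 (lebesgue_cyl oO tF))
  (g theta_r : L2 (lebesgue_on oO))
  (rho_u : R) (rho_u_gt0 : 0 < rho_u)
  (nK : nat) (XK : set (H1pair d oO)) (phi : 'I_nK -> H1pair d oO)
  (XK_H10 : XK `<=` @H10 R d Omega oO) (phi_orthonormal : L2orthonormal phi)
  (phi_basis : XK = spanned_by phi) :
  let T := TK (tF := tF) a b c XK beta in
  let theta_ro := theta_r - mild_solution SA tF fS g in
  let solution (u : 'I_m -> L2 (lebesgue_time tF)) := forall i : 'I_m,
    L2eq (rho_u *: u i + adjoint T (T u - theta_ro) i) 0 in
  let F := mxF tF a b c phi beta in
  let G := mxG tF a b c phi beta in
  rho_u%:M + G \in unitmx /\
  exists uK : 'I_m -> L2 (lebesgue_time tF),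
    [/\ solution uK,
        forall u, solution u -> forall i, L2eq (u i) (uK i)
      & forall tau, tau \in `[0, tF] -> forall i,
          uK i tau =
          (F tau *m invmx (rho_u%:M + G) *m vec_theta phi theta_ro) i ord0].
Proof.
subst XK; move=> T theta_ro solution F G.
pose FL := mxF_L2 tF_gt0 a b c beta phi.
pose theta := vec_theta phi theta_ro.
(* In coordinates the equation is the finite-rank regularized least-squares problem for [FL]. *)
have solutionE u : solution u <->
    forall i, L2eq (rho_u *: u i + synthesis FL (analysis FL u - theta) i) 0.
  have E i : L2eq (rho_u *: u i + adjoint T (T u - theta_ro) i)
      (rho_u *: u i + synthesis FL (analysis FL u - theta) i).
    apply: L2eqD; first exact: L2eq_refl.
    rewrite -(vec_theta_TK tF_gt0 a b c beta phi_orthonormal u theta_ro).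
    exact: adjoint_TK.
  split => su i; first exact: L2eq_trans (L2eq_sym (E i)) (su i).
  exact: L2eq_trans (E i) (su i).
have -> : G = gram FL by exact: mxG_gram.
split; first exact: regularized_gram_unitmx.
exists (synthesis FL (invmx (rho_u%:M + gram FL) *m theta)); split.
- by apply/solutionE => i; exact: synthesis_solves.
- by move=> u /solutionE; exact: solution_synthesis.
(* [FL i k] is the function [tau |-> F tau i k] itself, so the formula holds pointwise and not only
   almost everywhere. *)
- move=> tau _ i; rewrite -mulmxA mxE L2_sumE; apply: eq_bigr => k _.
  by rewrite L2ZE mulrC.
Qed.
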